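(* Let $f:\mathbb{R}\to\mathbb{R}$ be a strictly increasing bijection of class $C^2$ such that the set $S=\{z: f'(z)=0\}$ is contained in $[0,1]$, satisfies $\mathcal{L}^1(S)>0$, and contains no nondegenerate interval. Define $u:\mathbb{R}^2\to\mathbb{R}$ by $u(t,x)=f^{-1}(x)$. Then $u$ is continuous and: (1) $u$ satisfies $\partial_t u+\partial_x(f(u))=1$ in $\mathcal{D}'(\mathbb{R}^2)$. (2) $u$ is not a Broad solution: there is a characteristic $\gamma$ of $u$ such that $t\mapsto u(t,\gamma(t))$ is not absolutely continuous (in particular it is not Lipschitz continuous). (3) $u$ is a Lagrangian solution: $\chi(t,\tau)=f(t+\tau)$ is a Lagrangian parameterization associated with $u$, and $\frac{d}{dt}u(t,\chi(t,\tau))=1$ for all $t,\tau$, so that the constant function $1$ is a Lagrangian source associated with $u$ and $\chi$. (4) There is a Lagrangian parameterization $\widetilde\chi$ associated with $u$ that includes all the vertical characteristics $t\mapsto x$ with $x\in f(S)$ and admits a Lagrangian source, but there is no bounded Borel function $\mathfrak{g}:\mathbb{R}^2\to\mathbb{R}$ which is a Lagrangian source associated both with $\chi$ and with $\widetilde\chi$. More precisely, no bounded Borel function $\mathfrak g$ satisfies both $\mathfrak{g}(t,\chi(t,\tau))=1$ for $\mathcal{L}^2$-a.e. $(t,\tau)$ and, for every $x\in f(S)$, $\mathfrak{g}(t,x)=0$ for $\mathcal{L}^1$-a.e. $t$.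
   Context: $\mathcal{L}^d$ is $d$-dimensional Lebesgue measure. A characteristic of $u$ is a $C^1$ function $\gamma:I\to\mathbb{R}$ ($I$ an interval) with $\dot\gamma(t)=f'(u(t,\gamma(t)))$. A continuous $u$ is a Broad solution if there is $G>0$ such that $t\mapsto u(t,\gamma(t))$ is $G$-Lipschitz for every characteristic $\gamma$. A Lagrangian parameterization associated with $u$ is a continuous function $\chi:\mathbb{R}^2\to\mathbb{R}$, $(t,y)\mapsto\chi(t,y)$, such that: for each $y$, $t\mapsto\chi(t,y)$ is a characteristic; for each $t$, $y\mapsto\chi(t,y)$ is nondecreasing; the map $(t,y)\mapsto(t,\chi(t,y))$ is onto $\mathbb{R}^2$. It includes a characteristic $\gamma$ if $\chi(\cdot,y)=\gamma$ for some $y$. $u$ is a Lagrangian solution if, for some Lagrangian parameterization $\chi$ and some $G>0$, $t\mapsto u(t,\chi(t,y))$ is $G$-Lipschitz for each $y$. A Lagrangian source associated with $u$ and $\chi$ is a bounded Borel function $\mathfrak{g}$ with $\frac{d}{dt}u(t,\chi(t,y))=\mathfrak{g}(t,\chi(t,y))$ in $\mathcal{D}'(\mathbb{R})$ for every $y\in\mathbb{R}$. *)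

(* Defs.v *)
From HB Require Import structures.
From mathcomp Require Import all_boot all_order all_algebra.
From mathcomp Require Import all_classical all_reals all_analysis.
Set Implicit Arguments.
Unset Strict Implicit.
Unset Printing Implicit Defensive.
Import Order.TTheory GRing.Theory Num.Theory.
Import numFieldNormedType.Exports.
Local Open Scope ring_scope.
Local Open Scope classical_set_scope.

(* Points of the plane are pairs (t, x), time first. *)

Section Definitions.
Variable R : realType.
Implicit Types (f h w phi gamma : R -> R) (u v g chi psi : R * R -> R).
Implicit Types (I : set R).

Definition C2 f : Prop :=
  (forall x, derivable f x 1) /\
  (forall x, derivable f^`() x 1) /\
  continuous f^`(2).

Definition nondegenerate_interval I : Prop :=
  is_interval I /\ exists a b, [/\ I a, I b & a < b].

(* The derivative is relative to I, hence one-sided at an endpoint that belongs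
   to I; the values of gamma outside I are irrelevant. *)
Definition has_derivative_within I gamma (d : R -> R) : Prop :=
  forall t, I t ->
    (s - t)^-1 * (gamma s - gamma t) @[s --> within I t^'] --> d t.

Definition characteristic f u I gamma : Prop :=
  [/\ nondegenerate_interval I,
      has_derivative_within I gamma (fun t => f^`() (u (t, gamma t))) &
      {within I, continuous (fun t => f^`() (u (t, gamma t)))}].

Definition broad_solution f u : Prop :=
  continuous u /\
  exists2 G : R, 0 < G & forall I gamma, characteristic f u I gamma ->
    G.-lipschitz_I (fun t => u (t, gamma t)).

Definition absolutely_continuous_itv (a b : R) h : Prop :=
  forall e : R, 0 < e -> exists2 d : R, 0 < d &
    forall (n : nat) (x y : 'I_n -> R),
      (forall i, [/\ a <= x i, x i <= y i & y i <= b]) ->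
      trivIset setT (fun i => `]x i, y i[%classic) ->
      \sum_(i < n) (y i - x i) < d ->
      \sum_(i < n) `|h (y i) - h (x i)| < e.

(* On a compact interval this is absolute continuity in the usual sense; on a
   general interval it is the local notion (t |-> t ^+ 2 on R satisfies it), the
   weakest in use, so that its negation is the strongest. *)
Definition absolutely_continuous_on I h : Prop :=
  forall a b, a <= b -> `[a, b] `<=` I -> absolutely_continuous_itv a b h.

Definition lagrangian_parameterization f u chi : Prop :=
  [/\ continuous chi,
      forall y, characteristic f u setT (fun t => chi (t, y)),
      forall t, {homo (fun y => chi (t, y)) : y1 y2 / y1 <= y2} &
      set_surj setT setT (fun p : R * R => (p.1, chi p))].

Definition includes chi gamma : Prop :=
  exists y, (fun t => chi (t, y)) = gamma.

Definition lagrangian_solution f u : Prop :=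
  continuous u /\
  exists2 chi, lagrangian_parameterization f u chi &
  exists2 G : R, 0 < G & forall y,
    G.-lipschitz (fun t => u (t, chi (t, y))).

Definition test_function phi : Prop :=
  (forall n x, derivable (phi^`(n)) x 1) /\
  compact (closure [set x | phi x != 0]).

Definition e_t : R * R := (1, 0).
Definition e_x : R * R := (0, 1).

Definition smooth2 psi : Prop :=
  forall s : seq (R * R), {subset s <= [:: e_t; e_x]} ->
    let dpsi := foldr (fun e k => 'D_e k) psi s in
    continuous dpsi /\
    forall p, derivable dpsi p e_t /\ derivable dpsi p e_x.

Definition test_function2 psi : Prop :=
  smooth2 psi /\ compact (closure [set p | psi p != 0]).

Definition lebesgue_measure2 :
    {measure set (measurableTypeR R * measurableTypeR R) -> \bar R} :=
  (@lebesgue_measure R \x @lebesgue_measure R)%E.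

(* w' = h in D'(R). *)
Definition distributional_derivative w h : Prop :=
  forall phi, test_function phi ->
    - (\int[@lebesgue_measure R]_t (w t * derive1 phi t)) =
    \int[@lebesgue_measure R]_t (h t * phi t).

(* u_t + (f(u))_x = g in D'(R^2). *)
Definition distributional_balance_law f u g : Prop :=
  forall psi, test_function2 psi ->
    - (\int[lebesgue_measure2]_p (u p * 'D_e_t psi p))
    - (\int[lebesgue_measure2]_p (f (u p) * 'D_e_x psi p)) =
    \int[lebesgue_measure2]_p (g p * psi p).

(* The sigma-algebra on R * R is the product of the Borel ones, that is, the
   Borel sigma-algebra of the plane. *)
Definition bounded_borel g : Prop :=
  measurable_fun [set: measurableTypeR R * measurableTypeR R] g /\
  exists M : R, forall p, `|g p| <= M.

Definition lagrangian_source u chi g : Prop :=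
  bounded_borel g /\
  forall y, distributional_derivative
    (fun t => u (t, chi (t, y))) (fun t => g (t, chi (t, y))).

End Definitions.

(* Main.v *)
Require Import Defs.
From HB Require Import structures.
From mathcomp Require Import all_boot all_order all_algebra.
From mathcomp Require Import all_classical all_reals all_analysis.
From mathcomp Require Import measurable_realfun ring lra.
Set Implicit Arguments.
Unset Strict Implicit.
Unset Printing Implicit Defensive.
Import Order.TTheory GRing.Theory Num.Theory.
Import numFieldNormedType.Exports.
Local Open Scope ring_scope.
Local Open Scope classical_set_scope.

(* Along a characteristic gamma, the function z = finv o gamma solves
   f'(z) z' = f'(z): it moves at unit speed off the critical set S and may rest
   on S. All the claims come from three ways to cross S.

   - Moving through S at unit speed gives chi, with source 1.
   - Jumping over S: z is the inverse of T(z) = z - |S `&` ]-oo, z]|, which is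
     continuous and strictly increasing because S contains no interval. As
     f' = 0 on S, f o z is still C^1, but z maps the null set T(S) onto S and is
     not absolutely continuous.
   - Stopping forever at S: in each gap of S the particle comes out of the left
     endpoint, crosses at unit speed, and stays at the right endpoint. Together
     with the constants in S these paths form chi', with source the indicator
     of the complement of f(S).

   Testing against smooth bumps turns a distributional derivative into an
   almost everywhere identity, so a common source of chi and chi' would be both
   1 and 0 almost everywhere on the lines x = f s, s in S, although |S| > 0. *)

(** * Smooth bump functions *)

(** The balance law alone cannot decide the source on the verticals over f(S): as f' = 0 on S, the
    set f(S) is Lebesgue null, so altering g there does not change it as a distribution on the
    plane. The contradiction has to be found in the coordinates (t, z) with x = f z, where the strip
    over S has positive measure.

    The jump is admissible because the increment of f over [x, y] is the integral of f' over the
    part outside S, and the length of that part is exactly the time the jumping particle spends. So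
    f o z can be differentiated against time although z cannot.

    For the stopped motion the difficulty is that S may have infinitely many gaps accumulating at
    points of S, whereas one real parameter must list all paths continuously, monotonically and
    onto. The parameter is therefore taken on the same line as the positions: a point of S labels
    its own constant path, and a point of a gap labels one time shift of the path in that gap,
    through a logarithmic coordinate that blows up at the finite endpoints. Order between different
    gaps is then automatic. *)

Section Flat.
Variable R : realType.
Implicit Types (p q : {poly R}) (x y : R).

(* These functions are stable under differentiation, hence smooth, also at 0. *)
Definition flat p x := if 0 < x then p.[x^-1] * expR (- x^-1) else 0.

Lemma exprn_expRN_le (k : nat) : exists C : R, forall y, 0 < y ->
  y ^+ k * expR (- y) <= C.
Proof.
case: k => [|k]; first by exists 1 => y y0; rewrite mul1r -expR0 ler_expR; lra.
exists (k.+1%:R ^+ k.+1) => y y0.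
rewrite expRN ler_pdivrMr ?expR_gt0//.
(* With [n = k.+1], [expR y] is the n-th power of [expR (y / n)], which is at least [y / n]; this
   gives the bound [n ^+ n]. *)
have -> : y = k.+1%:R * (y / k.+1%:R) by rewrite mulrC divfK.
rewrite expRM_natl exprMn ler_pM2l ?exprn_gt0//.
apply: lerXn2r; rewrite ?nnegrE ?expR_ge0 ?divr_ge0 ?ler0n ?(ltW y0)//.
by apply: le_trans (expR_ge1Dx _); rewrite lerDr.
Qed.

Lemma horner_expRN_le p (k : nat) : exists C : R, forall y, 0 < y ->
  `|p.[y]| * y ^+ k * expR (- y) <= C.
Proof.
elim/poly_ind: p k => [|p c IH] k.
  by exists 0 => y _; rewrite horner0 normr0 !mul0r.
have [C1 h1] := IH k.+1; have [C2 h2] := exprn_expRN_le k.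
exists (C1 + `|c| * C2) => y y0.
rewrite hornerMXaddC.
apply: (@le_trans _ _ ((`|p.[y]| * y + `|c|) * y ^+ k * expR (- y))).
  rewrite ler_wpM2r ?expR_ge0// ler_wpM2r ?exprn_ge0 ?(ltW y0)//.
  by rewrite (le_trans (ler_normD _ _))// normrM (gtr0_norm y0).
rewrite !mulrDl lerD//.
  by move: (h1 _ y0); rewrite exprS !mulrA.
by rewrite -mulrA ler_wpM2l// h2.
Qed.

(** Bounding [|p.[y]| * y * expR (- y)] at [y = x^-1] leaves one spare factor [x]. This decay forces
    the derivative at 0 to vanish. *)
Lemma flat_le p : exists2 C : R, 0 <= C & forall x, `|flat p x| <= C * `|x|.
Proof.
have [C hC] := horner_expRN_le p 1.
exists `|C| => // x; rewrite /flat; case: ifPn => [x0|_]; last first.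
  by rewrite normr0 mulr_ge0.
have xV : 0 < x^-1 by rewrite invr_gt0.
have := hC _ xV; rewrite expr1 normrM (gtr0_norm (expR_gt0 _)) (gtr0_norm x0).
move=> h; rewrite -ler_pdivrMr//.
by rewrite mulrAC (le_trans h)// ler_norm.
Qed.

(** For positive [x] the product and chain rules put [(p - p')(1/x) / x ^+ 2] in front of the
    exponential, again a polynomial in [x^-1]; hence the factor ['X^2]. *)
Lemma is_derive_flat p x : is_derive x 1 (flat p) (flat ((p - p^`()) * 'X^2) x).
Proof.
have [x0|x0|->] := ltgtP x 0.
- have -> : flat ((p - p^`()) * 'X^2) x = 0 by rewrite /flat ltNge ltW.
  apply: (@near_eq_is_derive _ _ _ (cst 0)).
  near=> y; rewrite /flat ltNge ltW//.
  by near: y; exact: lt_nbhsl.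
- apply: (@near_eq_is_derive _ _ _ (fun x => p.[x^-1] * expR (- x^-1))).
    near=> y; rewrite /flat.
    have -> // : 0 < y by near: y; exact: lt_nbhsr.
  have xn0 : x != 0 by rewrite gt_eqF.
  have dV : is_derive x 1 (fun y : R => y^-1) (- x ^- 2).
    apply: is_derive_eq (is_deriveV _ _) _ => //.
    by rewrite /GRing.scale /= mulr1.
  have dp : is_derive x 1 (fun y : R => p.[y^-1]) (p^`().[x^-1] * (- x ^- 2)).
    by apply: (@is_derive1_comp _ (horner p)); exact: is_derive_poly.
  have de : is_derive x 1 (fun y : R => expR (- y^-1)) (expR (- x^-1) * (x ^- 2)).
    apply: (@is_derive1_comp _ expR (fun y => - y^-1)).
    by apply: is_derive_eq; rewrite opprK.
  apply: is_derive_eq.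
  rewrite /flat x0 /GRing.scale/= !(hornerM, hornerX, hornerD, hornerN).
  by field.
(* At 0 one factor [y] is pulled out of [flat p y]: the difference quotient becomes [flat (p * 'X)],
   which tends to 0 by the linear bound. *)
- have [C C0 hC] := flat_le (p * 'X).
  have fl y : flat p y = flat (p * 'X) y * y.
    rewrite /flat; case: ifPn => [y0|]; last by rewrite mul0r.
    by rewrite hornerMX mulrAC mulfVK// gt_eqF.
  have f0 q : flat q 0 = 0 by rewrite /flat ltxx.
  rewrite f0.
  have cv : h^-1 *: ((flat p \o shift 0) (h *: (1:R)) - flat p 0) @[h --> 0^'] --> (0:R).
    apply/cvgrPdist_le => e e0.
    near=> h.
    rewrite f0 subr0 sub0r normrN /= addr0 /GRing.scale/= mulr1 fl mulrCA mulVf; last first.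
      by near: h; exact: nbhs_dnbhs_neq.
    rewrite mulr1 (le_trans (hC _))//.
    have : `|h| <= e / (C + 1).
      near: h; apply: dnbhs0_le.
      by rewrite divr_gt0// ltr_wpDl.
    rewrite ler_pdivlMr ?ltr_wpDl// => /(le_trans _); apply.
    by rewrite mulrC ler_wpM2l// lerDl.
  by apply: DeriveDef; [apply/cvg_ex; exists 0|apply/cvg_lim].
Unshelve. all: by end_near.
Qed.

End Flat.

(** * Bumps as test functions, and almost everywhere identities from them *)

Section TestFunctions.
Variable R : realType.
Implicit Types (phi : R -> R).
Local Notation mu := (@lebesgue_measure R).

(** Smoothness by closure: the members are derivable and the class is stable under [derive1], so one
    induction yields every iterated derivative of [bump]. *)
Inductive flat_algebra : (R -> R) -> Prop :=
| flat_algebra_affine (p : {poly R}) (a b : R) :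
    flat_algebra (fun t => flat p (a * t + b))
| flat_algebraD phi1 phi2 : flat_algebra phi1 -> flat_algebra phi2 ->
    flat_algebra (fun t => phi1 t + phi2 t)
| flat_algebraM phi1 phi2 : flat_algebra phi1 -> flat_algebra phi2 ->
    flat_algebra (fun t => phi1 t * phi2 t).

Lemma flat_algebra_derive1 phi : flat_algebra phi ->
  (forall x, derivable phi x 1) /\ flat_algebra phi^`().
Proof.
elim => {phi} [p a b|f g _ [df Df] _ [dg Dg]|f g Cf [df Df] Cg [dg Dg]].
(* The chain rule factor [a] is absorbed into the polynomial, so the class can do without scalar
   multiples. *)
- pose q := a *: ((p - p^`()%R) * 'X^2).
  have der (x : R) : is_derive x 1 (fun t => flat p (a * t + b)) (flat q (a * x + b)).
    have ->: flat q (a * x + b) = flat ((p - p^`()%R) * 'X^2) (a * x + b) * a.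
      rewrite /flat; case: ifP => _; last by rewrite mul0r.
      by rewrite /q hornerZ -mulrA mulrC.
    apply: (@is_derive1_comp _ (flat p) (fun t => a * t + b)).
      exact: is_derive_flat.
    by apply: is_derive_eq; rewrite /GRing.scale/=; ring.
  split=> [x|]; first by have [] := der x.
  rewrite (_ : derive1 _ = fun t => flat q (a * t + b)); last first.
    by apply/funext => x; rewrite derive1E; have [] := der x.
  exact: flat_algebra_affine.
- split=> [x|]; first exact: derivableD.
  rewrite (_ : derive1 _ = fun t => derive1 f t + derive1 g t); last first.
    by apply/funext => x; rewrite !derive1E deriveD.
  exact: flat_algebraD.
- split=> [x|]; first exact: derivableM.
  rewrite (_ : derive1 _ = fun t => f t * derive1 g t + g t * derive1 f t); last first.
    by apply/funext => x; rewrite !derive1E deriveM.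
  by apply: flat_algebraD; exact: flat_algebraM.
Qed.

Lemma flat_algebra_derive1n phi n : flat_algebra phi -> flat_algebra phi^`(n).
Proof.
by elim: n => [//|n IH] /IH; rewrite derive1nS => /flat_algebra_derive1[].
Qed.

Lemma flat1_ge0 (x : R) : 0 <= flat 1 x.
Proof. by rewrite /flat; case: ifP => // _; rewrite hornerE mul1r expR_ge0. Qed.

Lemma flat1_le1 (x : R) : flat 1 x <= 1.
Proof.
rewrite /flat; case: ifP => // x0; rewrite hornerE mul1r -expR0 ler_expR.
by rewrite oppr_le0 invr_ge0 ltW.
Qed.

(** Smooth stand-ins for the indicator of []a, b[]: [flat 1] vanishes on the nonpositive half-line
    and tends to 1 at infinity, and [n.+1] steepens both edges. The expanded affine arguments match
    [flat_algebra_affine]. *)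
Definition bump (a b : R) (n : nat) (t : R) :=
  flat 1 (n.+1%:R * t + - (n.+1%:R * a)) * flat 1 (- n.+1%:R * t + n.+1%:R * b).

Lemma bumpE (a b t : R) n : bump a b n t =
  flat 1 (n.+1%:R * (t - a)) * flat 1 (n.+1%:R * (b - t)).
Proof. by rewrite /bump !mulrBr mulNr (addrC (- _)). Qed.

Lemma bump_neq0 (a b t : R) n : bump a b n t != 0 -> a < t < b.
Proof.
rewrite bumpE mulf_eq0 negb_or /flat => /andP[].
case: ifP; rewrite ?eqxx// pmulr_rgt0// subr_gt0 => -> _.
by case: ifP; rewrite ?eqxx// pmulr_rgt0// subr_gt0 => ->.
Qed.

Lemma test_function_bump (a b : R) n : test_function (bump a b n).
Proof.
have cl : flat_algebra (bump a b n).
  by apply: flat_algebraM; exact: flat_algebra_affine.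
split=> [k x|].
  by have [] := flat_algebra_derive1 (flat_algebra_derive1n k cl).
apply: (@subclosed_compact _ _ `[a, b]); first exact: closed_closure.
  exact: segment_compact.
rewrite [X in _ `<=` X](closure_id _).1; last exact: itv_closed.
apply: closureS => t /= /bump_neq0 /andP[at_ tb].
by rewrite in_itv/= !ltW.
Qed.

Lemma bump_cvg (a b t : R) :
  bump a b n t @[n --> \oo] --> (\1_(`]a, b[%classic) t : R).
Proof.
have [tab|tab] := boolP (t \in `]a, b[%classic); last first.
  rewrite indicE (negbTE tab)/=.
  apply: cvg_near_cst; near=> n; apply/eqP; apply: contraNT tab.
  by move=> /bump_neq0 tab; rewrite inE/= in_itv/=.
rewrite indicE tab /=; move: tab; rewrite inE/= in_itv/= => /andP[ta tb].
have key s : 0 < s -> flat 1 (n.+1%:R * s) @[n --> \oo] --> (1 : R).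
  move=> s0.
  have -> : (fun n => flat 1 (n.+1%:R * s)) =
            (fun n : nat => expR (- (s^-1 * harmonic n))).
    apply/funext => n; rewrite /flat pmulr_rgt0// s0 hornerE mul1r.
    by rewrite invfM mulrC.
  rewrite -[X in _ --> X]expR0; apply: continuous_cvg; first exact: continuous_expR.
  rewrite -[X in _ --> X]oppr0 -(mulr0 s^-1).
  by apply: cvgN; apply: cvgMr; exact: cvg_harmonic.
rewrite -[X in _ --> X]mulr1.
under eq_fun do rewrite bumpE.
by apply: cvgM; apply: key; rewrite subr_gt0.
Unshelve. all: by end_near.
Qed.

Lemma integrable_bounded_support (h : R -> R) (C a b : R) :
  measurable_fun setT h -> (forall x, `|h x| <= C) ->
  (forall x, h x != 0 -> a <= x <= b) -> mu.-integrable setT (EFin \o h).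
Proof.
move=> mh hC hab.
have -> : EFin \o h = (EFin \o h) \_ `[a, b].
  apply/funext => x; rewrite /patch/=; case: ifPn => //.
  rewrite notin_setE/= in_itv/= => xab; congr EFin; apply/eqP.
  by apply: contra_notT xab; exact: hab.
apply/integrable_restrict => //; rewrite setTI.
apply: measurable_bounded_integrable => //.
- by apply: compact_finite_measure; exact: segment_compact.
- exact: measurable_funS mh.
- exists C; split; first exact: num_real.
  by move=> M CM x _ /=; apply: (le_trans (hC x)); exact: ltW.
Qed.

Lemma integrable_mul_test (h phi : R -> R) (C : R) : measurable_fun setT h ->
  (forall x, `|h x| <= C) -> test_function phi ->
  mu.-integrable setT (EFin \o (fun t => h t * phi t)).
Proof.
move=> mh hC [phiS cphi].
have cph : continuous phi.
  by move=> x; apply/differentiable_continuous/derivable1_diffP/(phiS 0%N).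
have [M [_ hM]] := compact_bounded cphi.
have hM1 x : phi x != 0 -> - (`|M| + 1) <= x <= `|M| + 1.
  move=> px; rewrite -ler_norml; apply: hM; last exact: subset_closure.
  by rewrite (le_lt_trans (ler_norm _))// ltrDl.
have [N [_ hN]] := compact_bounded (continuous_compact
  (continuous_subspaceT cph : {within `[- (`|M| + 1), `|M| + 1], continuous phi})
  (@segment_compact _ _ _)).
have hN1 x : `|phi x| <= `|N| + 1.
  have [->|px] := eqVneq (phi x) 0; first by rewrite normr0 addr_ge0.
  apply: (hN (`|N| + 1)); first by rewrite (le_lt_trans (ler_norm _))// ltrDl.
  by exists x => //=; rewrite in_itv/=; exact: hM1.
apply: (@integrable_bounded_support _ (C * (`|N| + 1)) (- (`|M| + 1)) (`|M| + 1)).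
- by apply: measurable_funM => //; exact: continuous_measurable_fun.
- move=> x; rewrite normrM ler_pM//.
- by move=> x; rewrite mulf_eq0 negb_or => /andP[_ /hM1].
Qed.

(** Dominated convergence along the bumps makes the integral of [h] vanish over every bounded
    interval. The primitives of [h] are then 0, and Lebesgue differentiation gives [h = 0] almost
    everywhere. *)
Lemma ae_eq0_test (h : R -> R) (C : R) : measurable_fun setT h ->
  (forall x, `|h x| <= C) ->
  (forall phi, test_function phi -> \int[mu]_t (h t * phi t) = 0) ->
  {ae mu, forall t, h t = 0}.
Proof.
move=> mh hC h0.
have C0 : 0 <= C by rewrite (le_trans _ (hC 0)).
have ih (A : set R) : measurable A -> (mu A < +oo)%E ->
    mu.-integrable A (EFin \o h).
  move=> mA Aoo; apply: measurable_bounded_integrable => //.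
    exact: measurable_funS mh.
  exists C; split; first exact: num_real.
  by move=> M CM x _ /=; apply: (le_trans (hC x)); exact: ltW.
have itv_fin (a b : R) (A : set R) : measurable A -> A `<=` `[a, b] ->
    (mu A < +oo)%E.
  move=> mA Aab; apply: (@le_lt_trans _ _ (mu `[a, b])).
    by apply: le_measure; rewrite ?inE.
  by apply: compact_finite_measure; exact: segment_compact.
have hitv (a b : R) : mu.-integrable `]a, b[ (EFin \o h).
  by apply: ih => //; apply: itv_fin => //; exact: subset_itv_oo_cc.
have hitv1 (a b : R) : mu.-integrable `]a, b] (EFin \o h).
  by apply: ih => //; apply: itv_fin => //; exact: subset_itv_oc_cc.
have I0 (a b : R) : \int[mu]_(t in `]a, b]) h t = 0.
  rewrite -Rintegral_itv_bndo_bndc//.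
  pose f_ n (t : R) : \bar R := (h t * bump a b n t)%:E.
  have ig : mu.-integrable setT (EFin \o (fun t => C * \1_(`]a, b[%classic) t)).
    apply: (@integrable_bounded_support _ C a b).
    - exact: measurable_funM.
    - move=> x; rewrite normrM (ger0_norm C0) -[leRHS]mulr1 ler_wpM2l//.
      by rewrite ger0_norm// indicE; case: (_ \in _).
    - move=> x; rewrite mulf_eq0 negb_or => /andP[_].
      rewrite indicE; case: (boolP (_ \in _)); rewrite ?eqxx// inE/= in_itv/=.
      by move=> /andP[? ?] _; rewrite !ltW.
  have [||||_ _] := @dominated_convergence _ _ _ mu setT measurableT f_
    (fun t => (h t * \1_(`]a, b[%classic) t)%:E)
    (EFin \o (fun t => C * \1_(`]a, b[%classic) t)) _ _ _ ig _.
  - move=> n; apply/measurable_EFinP.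
    have /integrableP[/measurable_EFinP] :=
      integrable_mul_test mh hC (test_function_bump a b n).
    by [].
  - by apply/measurable_EFinP; exact: measurable_funM.
  - apply: aeW => t _; apply: cvg_EFin; first exact: nearW.
    by apply: cvgMr; exact: bump_cvg.
  - apply: aeW => t n _; rewrite /f_ /= lee_fin normrM.
    rewrite ler_pM//.
    have [->|/bump_neq0 tab] := eqVneq (bump a b n t) 0.
      by rewrite normr0 indicE.
    rewrite indicE mem_set//= bumpE normrM !ger0_norm ?flat1_ge0//.
    by rewrite mulr_ile1 ?flat1_ge0 ?flat1_le1.
  have -> : (fun n => (\int[mu]_x f_ n x)%E) = cst 0%E.
    apply/funext => n; have := h0 _ (test_function_bump a b n).
    rewrite /Rintegral => fi0.
    rewrite -[LHS]fineK ?fi0// integrable_fin_num//.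
    by apply: integrable_mul_test hC _ => //; exact: test_function_bump.
  move=> cv; rewrite Rintegral_mkcond /Rintegral.
  rewrite (_ : (\int[mu]_x _)%E = 0%E)//.
  transitivity (\int[mu]_x (h x * \1_(`]a, b[%classic) x)%:E)%E.
    apply: eq_integral => x _; rewrite /patch indicE.
    by case: ifP; rewrite ?mulr1 ?mulr0.
  by rewrite -(cvg_lim (@ereal_hausdorff R) cv) lim_cst//; exact: ereal_hausdorff.
have loch : locally_integrable setT h.
  split => //; first exact: openT.
  move=> K _ cK.
  have : mu.-integrable K (EFin \o h).
    by apply: ih; [exact: compact_measurable|exact: compact_finite_measure].
  by move=> /integrableP[].
(* The primitive starts at [- n], and countably many such base points exhaust the line. *)
have ftc (n : nat) : {ae mu, forall t, - n%:R < t -> h t = 0}.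
  have := @FTC1 _ h (BRight (- n%:R)) (fun y => hitv1 _ _) loch.
  apply: filterS; first exact: (ae_filter_ringOfSetsType mu).
  move=> t /= hF nt.
  have [|_ <-] := hF; first by rewrite lte_fin.
  rewrite (_ : (fun _ => _) = cst 0) ?derive1_cst//.
  by apply/funext => x; exact: I0.
have : {ae mu, forall t (n : nat), - n%:R < t -> h t = 0}.
  exact/ae_foralln.
apply: filterS; first exact: (ae_filter_ringOfSetsType mu).
move=> t /(_ (Num.truncn `|t|).+1); apply.
by rewrite ltrNl (le_lt_trans _ (truncnS_gt _))// -normrN ler_norm.
Qed.

Lemma distributional_derivative_unique (w h1 h2 : R -> R) (C1 C2 : R) :
  measurable_fun setT h1 -> (forall x, `|h1 x| <= C1) ->
  measurable_fun setT h2 -> (forall x, `|h2 x| <= C2) ->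
  distributional_derivative w h1 -> distributional_derivative w h2 ->
  {ae mu, forall t, h1 t = h2 t}.
Proof.
move=> m1 b1 m2 b2 d1 d2.
have : {ae mu, forall t, h1 t - h2 t = 0}.
  apply: (@ae_eq0_test _ (C1 + C2)).
  - exact: measurable_funB.
  - by move=> x; rewrite (le_trans (ler_normB _ _))// lerD.
  - move=> phi tphi; under eq_Rintegral do rewrite mulrBl.
    rewrite RintegralB//=; first by rewrite -(d1 _ tphi) -(d2 _ tphi) subrr.
    + exact: integrable_mul_test b1 _.
    + exact: integrable_mul_test b2 _.
by apply: filterS; first exact: (ae_filter_ringOfSetsType mu); move=> t /eqP; rewrite subr_eq0 => /eqP.
Qed.

End TestFunctions.

(** * Distributional derivatives on the line *)

Section OneDimensional.
Variable R : realType.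
Implicit Types (phi w h : R -> R).
Local Notation mu := (@lebesgue_measure R).

Lemma test_function_continuous phi : test_function phi ->
  continuous phi /\ continuous phi^`().
Proof.
move=> [phiS _]; split=> x; apply/differentiable_continuous/derivable1_diffP.
  exact: (phiS 0%N).
exact: (phiS 1%N).
Qed.

Lemma derive1_near0 (phi : R -> R) (M t : R) : (forall s, M <= `|s| -> phi s = 0) ->
  M < `|t| -> derive1 phi t = 0.
Proof.
move=> phi0 Mt; rewrite derive1E (@near_eq_derive _ _ _ _ (cst 0)) ?derive_cst ?oner_neq0//.
near=> y; apply: phi0; apply: ltW; near: y.
have op : open [set y : R | M < `|y|].
  apply: (@open_comp _ _ (fun y : R => `|y|) [set y | M < y]).
    by move=> y _; exact: norm_continuous.
  exact: open_gt.
exact: open_nbhs_nbhs.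
Unshelve. all: by end_near.
Qed.

Lemma test_function_support phi : test_function phi ->
  exists2 M, 0 < M & forall x, M <= `|x| -> phi x = 0 /\ derive1 phi x = 0.
Proof.
move=> [_ /compact_bounded [M [_ hM]]].
have out x : `|M| + 1 < `|x| -> phi x = 0.
  move=> xM; apply/eqP; apply/negPn/negP => px; move: xM; apply/negP.
  rewrite -leNgt; apply: hM; last exact: subset_closure.
  by rewrite (le_lt_trans (ler_norm _))// ltrDl.
(* The margin beyond [|M| + 1] leaves a whole neighbourhood of [x] on which [phi] is 0, so the
   derivative vanishes too. *)
exists (`|M| + 2) => [|x xM]; first by rewrite ltr_wpDl.
have xM1 : `|M| + 1 < `|x| by rewrite (lt_le_trans _ xM)// ltrD2l ltr1n.
split; first exact: out.
apply: (@derive1_near0 _ (`|M| + 3 / 2)); last by lra.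
by move=> s hs; apply: out; lra.
Qed.

Lemma support_restrict h (M : R) : (forall x, M <= `|x| -> h x = 0) ->
  h = h \_ `[- M, M].
Proof.
move=> h0; apply/funext => x; rewrite /patch; case: ifPn => //.
rewrite notin_setE/= in_itv/= -ler_norml => /negP; rewrite -ltNge => /ltW.
exact: h0.
Qed.

Lemma integrable_continuous_support h (M : R) : continuous h ->
  (forall x, M <= `|x| -> h x = 0) -> mu.-integrable setT (EFin \o h).
Proof.
move=> ch h0.
rewrite (support_restrict h0) -restrict_EFin.
apply/integrable_restrict => //; rewrite setTI.
apply: continuous_compact_integrable; first exact: segment_compact.
exact: continuous_subspaceT.
Qed.

Lemma integrable_mul_derive_test w phi : continuous w -> test_function phi ->
  mu.-integrable setT (EFin \o (fun t => w t * derive1 phi t)).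
Proof.
move=> cw tphi; have [_ cphi'] := test_function_continuous tphi.
have [M M0 hM] := test_function_support tphi.
apply: (@integrable_continuous_support _ M).
  by move=> x; apply: continuousM; [exact: cw|exact: cphi'].
by move=> x /hM[_ ->]; rewrite mulr0.
Qed.

Lemma Rintegral_affine_parts (a b l r : R) phi :
  (forall x, derivable phi x 1) -> continuous (derive1 phi) -> l < r ->
  \int[mu]_(t in `[l, r]) ((a * t + b) * derive1 phi t) =
  (a * r + b) * phi r - (a * l + b) * phi l - \int[mu]_(t in `[l, r]) (a * phi t).
Proof.
move=> dphi cphi' lr.
have cphi : continuous phi.
  by move=> x; apply/differentiable_continuous/derivable1_diffP.
have cc (k : R -> R) (x y : R) : continuous k ->
    {in `]x, y[%R, forall z, derivable k z 1} -> derivable_oo_LRcontinuous k x y.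
  move=> ck dk; split => //.
    by apply: cvg_at_right_filter; exact: ck.
  by apply: cvg_at_left_filter; exact: ck.
have dw (x : R) : is_derive x 1 (fun t => a * t + b) a.
  by apply: is_derive_eq; rewrite /GRing.scale/=; ring.
have cw : continuous (fun t : R => a * t + b).
  by move=> x; apply/differentiable_continuous/derivable1_diffP; have [] := dw x.
apply: (@Rintegration_by_parts _ (fun t => a * t + b) phi (cst a) (derive1 phi)).
- exact: lr.
- by apply: continuous_subspaceT => x; exact: cst_continuous.
- by apply: cc; [exact: cw|move=> x _; have [] := dw x].
- by move=> x _; rewrite derive1E; have [] := dw x.
- exact: continuous_subspaceT cphi'.
- by apply: cc; [exact: cphi|move=> x _; exact: dphi].
- by [].
Qed.

Lemma Rintegral_affine_support (a b M : R) phi :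
  (forall x, derivable phi x 1) -> continuous (derive1 phi) -> 0 < M ->
  (forall x, M <= `|x| -> phi x = 0 /\ derive1 phi x = 0) ->
  \int[mu]_t ((a * t + b) * derive1 phi t) = - \int[mu]_t (a * phi t).
Proof.
move=> dphi cphi' M0 hM.
have MM : M <= `|M| by rewrite gtr0_norm.
have nMM : M <= `|- M| by rewrite normrN.
have e1 : \int[mu]_t ((a * t + b) * derive1 phi t) =
    \int[mu]_(t in `[- M, M]) ((a * t + b) * derive1 phi t).
  rewrite [RHS]Rintegral_mkcond -support_restrict//.
  by move=> x /hM[_ ->]; rewrite mulr0.
have e2 : \int[mu]_t (a * phi t) = \int[mu]_(t in `[- M, M]) (a * phi t).
  rewrite [RHS]Rintegral_mkcond -support_restrict//.
  by move=> x /hM[-> _]; rewrite mulr0.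
have lr : - M < M by rewrite gtrN.
rewrite e1 e2 (Rintegral_affine_parts a b dphi cphi' lr).
by rewrite (hM _ MM).1 (hM _ nMM).1 !mulr0 subrr sub0r.
Qed.

(** Integration by parts on both sides of [c]: the boundary terms at [c] cancel because both affine
    formulas hold there, and those at the far ends vanish with the test function. The value [h c] is
    free, a point being null. *)
Lemma distributional_derivative_piecewise (a1 b1 a2 b2 c C : R) w h :
  continuous w -> measurable_fun setT h -> (forall t, `|h t| <= C) ->
  (forall t, t <= c -> w t = a1 * t + b1) ->
  (forall t, c <= t -> w t = a2 * t + b2) ->
  (forall t, t < c -> h t = a1) -> (forall t, c < t -> h t = a2) ->
  distributional_derivative w h.
Proof.
move=> cw mh hC w1 w2 h1 h2 phi tphi.
have [M M0 hM] := test_function_support tphi.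
have [cphi cphi'] := test_function_continuous tphi.
have iw := integrable_mul_derive_test cw tphi.
have ih := integrable_mul_test mh hC tphi.
(* Large enough for []- N, N[] to contain the kink [c] as well as every point where [phi] is
   nonzero. *)
pose N := M + `|c|.
have NM : M <= N by rewrite lerDl.
have N0 : 0 < N by rewrite (lt_le_trans M0).
have /andP[Nc cN] : - N < c < N by rewrite -ltr_norml ltrDr.
have NN : M <= `|N| by rewrite ger0_norm// ltW.
have nNN : M <= `|- N| by rewrite normrN.
have split_int (k : R -> R) : mu.-integrable setT (EFin \o k) ->
    (forall x, M <= `|x| -> k x = 0) ->
    \int[mu]_t k t = \int[mu]_(t in `[- N, c]) k t + \int[mu]_(t in `[c, N]) k t.
  move=> ik k0.
  have sub (A : set R) : measurable A -> mu.-integrable A (EFin \o k).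
    by move=> mA; apply: integrableS ik.
  rewrite {1}(@support_restrict k N); last by move=> x /(le_trans NM); exact: k0.
  rewrite -Rintegral_mkcond.
  rewrite -(@Rintegral_itv_obnd_cbnd _ c (BRight N)); last exact: sub.
  rewrite -(@Rintegral_itvB _ k (BLeft (- N)) (BRight N) c); last 3 first.
  - exact: sub.
  - by rewrite bnd_simp ltW.
  - by rewrite bnd_simp ltW.
  by rewrite addrCA subrr addr0.
rewrite split_int//; last by move=> x /hM[_ ->]; rewrite mulr0.
rewrite split_int//; last by move=> x /hM[-> _]; rewrite mulr0.
have -> : \int[mu]_(t in `[- N, c]) (w t * derive1 phi t) =
    \int[mu]_(t in `[- N, c]) ((a1 * t + b1) * derive1 phi t).
  by apply: eq_Rintegral => t; rewrite inE/= in_itv/= => /andP[_ tc]; rewrite w1.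
have -> : \int[mu]_(t in `[c, N]) (w t * derive1 phi t) =
    \int[mu]_(t in `[c, N]) ((a2 * t + b2) * derive1 phi t).
  by apply: eq_Rintegral => t; rewrite inE/= in_itv/= => /andP[tc _]; rewrite w2.
rewrite (@Rintegral_affine_parts a1 b1 _ _ phi (tphi.1 0%N) cphi' Nc).
rewrite (@Rintegral_affine_parts a2 b2 _ _ phi (tphi.1 0%N) cphi' cN).
rewrite (hM _ NN).1 (hM _ nNN).1.
have sub (k : R -> R) (A : set R) : measurable A ->
    mu.-integrable setT (EFin \o k) -> mu.-integrable A (EFin \o k).
  by move=> mA; exact: integrableS.
have ia (a : R) : mu.-integrable setT (EFin \o (fun t => a * phi t)).
  by apply: (integrable_mul_test _ (fun=> lexx `|a|) tphi).
have -> : \int[mu]_(t in `[- N, c]) (h t * phi t) =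
    \int[mu]_(t in `[- N, c]) (a1 * phi t).
  rewrite -Rintegral_itv_bndo_bndc; last exact: sub.
  rewrite -[RHS]Rintegral_itv_bndo_bndc; last exact: sub.
  by apply: eq_Rintegral => t; rewrite inE/= in_itv/= => /andP[_ tc]; rewrite h1.
have -> : \int[mu]_(t in `[c, N]) (h t * phi t) =
    \int[mu]_(t in `[c, N]) (a2 * phi t).
  rewrite -Rintegral_itv_obnd_cbnd; last exact: sub.
  rewrite -[RHS]Rintegral_itv_obnd_cbnd; last exact: sub.
  by apply: eq_Rintegral => t; rewrite inE/= in_itv/= => /andP[tc _]; rewrite h2.
have : a1 * c + b1 = a2 * c + b2 by rewrite -w1// -w2.
move=> ->; ring.
Qed.

(** The combination [w1 + w2 - w3] is the shape of [stopped] in a gap: two clampings minus a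
    translation, each with at most one kink. *)
Lemma distributional_derivativeDB (w1 w2 w3 h1 h2 h3 : R -> R) (C1 C2 C3 : R) :
  continuous w1 -> continuous w2 -> continuous w3 ->
  measurable_fun setT h1 -> measurable_fun setT h2 -> measurable_fun setT h3 ->
  (forall t, `|h1 t| <= C1) -> (forall t, `|h2 t| <= C2) ->
  (forall t, `|h3 t| <= C3) ->
  distributional_derivative w1 h1 -> distributional_derivative w2 h2 ->
  distributional_derivative w3 h3 ->
  distributional_derivative (fun t => w1 t + w2 t - w3 t)
    (fun t => h1 t + h2 t - h3 t).
Proof.
move=> cw1 cw2 cw3 m1 m2 m3 b1 b2 b3 d1 d2 d3 phi tphi.
have j1 := integrable_mul_derive_test cw1 tphi.
have j2 := integrable_mul_derive_test cw2 tphi.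
have j3 := integrable_mul_derive_test cw3 tphi.
have i1 := integrable_mul_test m1 b1 tphi.
have i2 := integrable_mul_test m2 b2 tphi.
have i3 := integrable_mul_test m3 b3 tphi.
have sumI (k1 k2 : R -> R) : mu.-integrable setT (EFin \o k1) ->
    mu.-integrable setT (EFin \o k2) ->
    mu.-integrable setT (EFin \o (fun t => k1 t + k2 t)).
  by move=> ik1 ik2; exact: (integrableD measurableT ik1 ik2).
under eq_Rintegral do rewrite mulrBl mulrDl.
under [RHS]eq_Rintegral do rewrite mulrBl mulrDl.
rewrite RintegralB//=; last exact: sumI.
rewrite RintegralD//= RintegralB//=; last exact: sumI.
by rewrite RintegralD//= -d1// -d2// -d3//; ring.
Qed.

End OneDimensional.

(** * The characteristic that jumps over the critical set *)

Section Occupation.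
Variable R : realType.
Local Notation mu := (@lebesgue_measure R).
Implicit Types (A : set R) (x y z : R).

Definition occupation A z : R := fine (mu (A `&` `]-oo, z])).

Lemma fin_measureI A (B : set R) : measurable A -> measurable B ->
  (mu A < +oo)%E -> mu (A `&` B) \is a fin_num.
Proof.
move=> mA mB Aoo; rewrite ge0_fin_numE//; apply: le_lt_trans Aoo.
by apply: le_measure; rewrite ?inE//; exact: measurableI.
Qed.

Lemma occupationB A x y : measurable A -> (mu A < +oo)%E -> x <= y ->
  occupation A y - occupation A x = fine (mu (A `&` `]x, y])).
Proof.
move=> mA Aoo xy; rewrite /occupation.
have -> : A `&` `]-oo, y] = (A `&` `]-oo, x]) `|` (A `&` `]x, y]).
  rewrite -setIUr; congr (_ `&` _); apply/seteqP; split => z /=; rewrite !in_itv/=.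
    by move=> zy; have [zx|xz] := leP z x; [left|right].
  by case=> [/le_trans|/andP[]//]; apply.
rewrite measureU//=; [|exact: measurableI|exact: measurableI|].
  rewrite fineD ?fin_measureI//.
  by rewrite addrAC subrr add0r.
apply/seteqP; split => z //= -[[_]]; rewrite !in_itv/= => zx [_ /andP[xz _]].
by move: (lt_le_trans xz zx); rewrite ltxx.
Qed.

Lemma occupation_ge0 A z : 0 <= occupation A z.
Proof. exact: fine_ge0. Qed.

Lemma occupation_le A z : measurable A -> (mu A < +oo)%E ->
  occupation A z <= fine (mu A).
Proof.
move=> mA Aoo; apply: fine_le; rewrite ?fin_measureI//.
  by rewrite ge0_fin_numE.
by apply: le_measure; rewrite ?inE//; exact: measurableI.
Qed.

Lemma lebesgue_measure_oc x y : x <= y -> mu `]x, y] = (y - x)%:E.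
Proof.
move=> xy; rewrite lebesgue_measure_itv/= lte_fin; case: ltP => [_|yx].
  by rewrite EFinB.
have -> : x = y by apply/eqP; rewrite eq_le xy.
by rewrite subrr.
Qed.

Lemma occupationB_subset A x y : measurable A -> (mu A < +oo)%E -> x <= y ->
  `]x, y] `<=` A -> occupation A y - occupation A x = y - x.
Proof.
move=> mA Aoo xy xyA; rewrite occupationB//.
by rewrite (setIidr xyA) lebesgue_measure_oc.
Qed.

Lemma occupation_homo A x y : measurable A -> (mu A < +oo)%E -> x <= y ->
  occupation A x <= occupation A y.
Proof. by move=> mA Aoo xy; rewrite -subr_ge0 occupationB// fine_ge0. Qed.

Lemma occupationBC A x y : measurable A -> (mu A < +oo)%E -> x <= y ->
  (y - occupation A y) - (x - occupation A x) = fine (mu (`]x, y] `&` ~` A)).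
Proof.
move=> mA Aoo xy.
have -> : y - occupation A y - (x - occupation A x) =
  (y - x) - (occupation A y - occupation A x) by ring.
rewrite occupationB//.
have mxy := lebesgue_measure_oc xy.
have e : mu `]x, y] = (mu (A `&` `]x, y]) + mu (`]x, y] `&` ~` A))%E.
  rewrite -measureU//.
  - by rewrite (setIC A) -setIUr setUv setIT.
  - exact: measurableI.
  - by apply: measurableI => //; exact: measurableC.
  - by apply/seteqP; split => z //= -[[Az _] [_]].
have fC : mu (`]x, y] `&` ~` A) \is a fin_num.
  by apply: fin_measureI => //; [exact: measurableC|rewrite mxy ltry].
have : (y - x)%:E = (fine (mu (A `&` `]x, y])) + fine (mu (`]x, y] `&` ~` A)))%:E.
  rewrite -mxy e EFinD; congr (_ + _)%E; rewrite fineK//; exact: fin_measureI.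
by move=> [->]; ring.
Qed.

Lemma sum_occupationB A (N : nat) (x : nat -> R) :
  \sum_(i < N) (occupation A (x i.+1) - occupation A (x i)) =
  occupation A (x N) - occupation A (x 0%N).
Proof.
by rewrite -(big_mkord xpredT (fun i => occupation A (x i.+1) - occupation A (x i)))
  telescope_sumr.
Qed.

End Occupation.

Section CompressedTime.
Variables (R : realType) (f : R -> R) (S : set R).
Local Notation mu := (@lebesgue_measure R).
Implicit Types (x y z s t : R).
Hypotheses (df : forall x, derivable f x 1) (cf' : continuous (derive1 f)).
Hypotheses (SE : forall x, S x -> derive1 f x = 0) (Sclosed : closed S).
Hypotheses (S01 : S `<=` `[0, 1]).
Hypothesis S_nointerval : forall J, nondegenerate_interval J -> ~ (J `<=` S).

Let mS : measurable S := closed_measurable Sclosed.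

Lemma critical_finite : (mu S < +oo)%E.
Proof.
apply: (@le_lt_trans _ _ (mu `[0, 1])).
  by apply: le_measure; rewrite ?inE.
by apply: compact_finite_measure; exact: segment_compact.
Qed.

(* The time a particle needs to reach z when it jumps across S instantaneously
   and moves at unit speed elsewhere. *)
Definition compressed z : R := z - occupation S z.

Lemma compressedB x y : x <= y ->
  compressed y - compressed x = fine (mu (`]x, y] `&` ~` S)).
Proof. by move=> xy; rewrite /compressed occupationBC//; exact: critical_finite. Qed.

Lemma compressed_lip x y : x <= y -> 0 <= compressed y - compressed x <= y - x.
Proof.
move=> xy; apply/andP; split; first by rewrite compressedB// fine_ge0.
rewrite /compressed.
have := occupation_homo mS critical_finite xy; lra.
Qed.

(** Some [p] in []x, y[] lies outside the closed set [S], hence has a neighbourhood free of [S], and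
    just to the left of [p] [compressed] gains the full length. *)
Lemma compressed_inc x y : x < y -> compressed x < compressed y.
Proof.
move=> xy.
have [p pxy pS] : exists2 p, x < p < y & ~ S p.
  apply: contrapT => h; apply: (@S_nointerval `]x, y[).
    split; first exact: interval_is_interval.
    exists (x + (y - x) / 3), (x + (y - x) / 2); rewrite /= !in_itv/=; split; lra.
  move=> p /=; rewrite in_itv/= => pxy; apply: contrapT => pS.
  by apply: h; exists p.
have [e e0 eS] : exists2 e : R, 0 < e & forall z, `|p - z| < e -> ~ S z.
  have := closed_openC Sclosed; rewrite openE => /(_ p pS).
  by move=> /nbhs_ballP[e e0 he]; exists e.
pose a := Num.max x (p - e / 2).
have ap : a < p by rewrite /a gt_max; lra.
have xa : x <= a by rewrite /a le_max lexx.
have mono u v : u <= v -> compressed u <= compressed v.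
  by move=> /compressed_lip/andP[]; rewrite subr_ge0.
have py : p <= y by lra.
have := mono _ _ xa; have := mono _ _ py.
suff : compressed p - compressed a = p - a by lra.
rewrite compressedB ?(ltW ap)// setIidl ?lebesgue_measure_oc ?(ltW ap)//.
move=> z /=; rewrite in_itv/= => /andP[az zp]; apply: eS.
have : p - e / 2 <= a by rewrite /a le_max lexx orbT.
rewrite ger0_norm; lra.
Qed.

Lemma compressed_continuous : continuous compressed.
Proof.
move=> x; apply/cvgrPdist_lt => e e0; near=> y.
have xye : `|x - y| < e by near: y; exact: cvgr_dist_lt.
apply: le_lt_trans xye.
have [xy|/ltW yx] := leP x y.
  have := compressed_lip xy.
  by rewrite distrC (distrC x) => /andP[h ?]; rewrite !ger0_norm// subr_ge0.
by have := compressed_lip yx; move=> /andP[h ?]; rewrite !ger0_norm// subr_ge0.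
Unshelve. all: by end_near.
Qed.

(** The time saved, [occupation S], stays between 0 and [m], so [t] is caught between the values of
    [compressed] at [t] and at [t + m]. *)
Lemma compressed_surj t : exists z, compressed z = t.
Proof.
pose m := fine (mu S).
have m0 : 0 <= m by rewrite fine_ge0.
have lo : compressed t <= t by rewrite lerBlDr lerDl occupation_ge0.
have hi : t <= compressed (t + m).
  by rewrite /compressed lerBrDr lerD2l occupation_le//; exact: critical_finite.
have [|||z _ zE] := @IVT _ compressed t (t + m) t.
- by rewrite lerDl.
- exact: continuous_subspaceT compressed_continuous.
- by rewrite ge_min lo le_max hi orbT.
by exists z.
Qed.

Definition decompressed t : R := sval (cid (compressed_surj t)).

Lemma decompressedK t : compressed (decompressed t) = t.
Proof. by rewrite /decompressed; case: cid. Qed.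

Lemma compressed_le x y : (compressed x <= compressed y) = (x <= y).
Proof.
have [xy|yx] := leP x y; last by apply/negbTE; rewrite -ltNge compressed_inc.
by rewrite -subr_ge0; have /andP[] := compressed_lip xy.
Qed.

Lemma compressedK z : decompressed (compressed z) = z.
Proof. by apply/le_anti/andP; split; rewrite -compressed_le decompressedK. Qed.

Lemma decompressed_le s t : (decompressed s <= decompressed t) = (s <= t).
Proof. by rewrite -compressed_le !decompressedK. Qed.

Lemma decompressed_continuous : continuous decompressed.
Proof.
move=> t; apply/cvgrPdist_lt => e e0.
have lo : compressed (decompressed t - e) < t.
  by rewrite -{2}(decompressedK t) compressed_inc// ltrBlDr ltrDl.
have hi : t < compressed (decompressed t + e).
  by rewrite -{1}(decompressedK t) compressed_inc// ltrDl.
near=> s.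
have ls : compressed (decompressed t - e) < s by near: s; exact: lt_nbhsr.
have sh : s < compressed (decompressed t + e) by near: s; exact: lt_nbhsl.
move: ls sh; rewrite -{1 2}(decompressedK s) !ltNge !compressed_le -!ltNge => ls sh.
rewrite ltr_distl; lra.
Unshelve. all: by end_near.
Qed.

(** A mean value inequality in compressed time: [f'] vanishes on [S], so [f y - f x] is the integral
    of [f'] over the part of []x, y]] outside [S], whose measure is the increment of
    [compressed]. *)
Lemma increment_compressed (m M x y : R) : x < y ->
  (forall z, x <= z <= y -> m <= derive1 f z <= M) ->
  m * (compressed y - compressed x) <= f y - f x <= M * (compressed y - compressed x).
Proof.
move=> xy mM.
have cf : continuous f.
  by move=> z; apply/differentiable_continuous/derivable1_diffP.
have ftc : \int[mu]_(z in `[x, y]) derive1 f z = f y - f x.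
  rewrite /Rintegral.
  have -> : (\int[mu]_(z in `[x, y]) (derive1 f z)%:E = (f y)%:E - (f x)%:E)%E.
    apply: (@continuous_FTC2 R (derive1 f) f x y xy); last by [].
      exact: continuous_subspaceT.
    split; first by move=> z _; exact: df.
      by apply: cvg_at_right_filter; exact: cf.
    by apply: cvg_at_left_filter; exact: cf.
  by [].
have ii : mu.-integrable `[x, y] (EFin \o derive1 f).
  by apply: continuous_compact_integrable; [exact: segment_compact|exact: continuous_subspaceT].
have mSC : measurable (~` S) by exact: measurableC.
have iD : mu.-integrable (`]x, y] `&` ~` S) (EFin \o derive1 f).
  apply: integrableS ii => //; first exact: measurableI.
  by move=> z /= [h _]; exact: subset_itv_oc_cc h.
have ic (c : R) : mu.-integrable (`]x, y] `&` ~` S) (EFin \o cst c).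
  apply: (@integrableS _ _ _ mu `[x, y]) => //; first exact: measurableI.
    by move=> z /= [h _]; exact: subset_itv_oc_cc h.
  apply: continuous_compact_integrable; first exact: segment_compact.
  by apply: continuous_subspaceT => z; exact: cst_continuous.
have -> : f y - f x = \int[mu]_(z in `]x, y] `&` ~` S) derive1 f z.
  rewrite -ftc -Rintegral_itv_obnd_cbnd; last first.
    by apply: integrableS ii => //; exact: subset_itv_oc_cc.
  rewrite Rintegral_mkcondr; apply: eq_Rintegral => z _; rewrite /patch.
  by case: ifPn => //; rewrite notin_setE/= => /contrapT /SE.
have mD : measurable (`]x, y] `&` ~` S) by exact: measurableI.
rewrite compressedB ?(ltW xy)// -!Rintegral_cst//.
have sub z : (`]x, y] `&` ~` S) z -> m <= derive1 f z <= M.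
  by move=> [/subset_itv_oc_cc/=]; rewrite in_itv/= => /mM.
apply/andP; split; apply: le_Rintegral.
- exact: mD.
- exact: ic.
- exact: iD.
- by move=> z /sub/andP[].
- exact: mD.
- exact: iD.
- exact: ic.
- by move=> z /sub/andP[].
Qed.

(** Between [decompressed t] and [decompressed s] the compressed increment is [s - t]. Dividing
    [increment_compressed] by it squeezes the quotient, and only monotonicity and continuity of
    [decompressed] enter. *)
Lemma decompressed_derive t :
  (s - t)^-1 * (f (decompressed s) - f (decompressed t)) @[s --> t^'] -->
  derive1 f (decompressed t).
Proof.
apply/cvgrPdist_le => e e0.
have /cvgrPdist_le/(_ e e0)/nbhs_ballP[d /= d0 hd] :
  derive1 f z @[z --> decompressed t] --> derive1 f (decompressed t) by exact: cf'.
have /cvgrPdist_lt/(_ d d0)/nbhs_ballP[r /= r0 hr] :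
  decompressed s @[s --> t] --> decompressed t by exact: decompressed_continuous.
near=> s.
have st : s != t by near: s; exact: nbhs_dnbhs_neq.
have ts : `|t - s| < r.
  by near: s; apply: nbhs_dnbhs; apply/nbhs_ballP; exists r.
set z := decompressed t; set w := decompressed s.
have zw : `|z - w| < d by exact: hr.
have key (x y : R) : x < y -> `|z - x| < d -> `|z - y| < d ->
    (derive1 f z - e) * (compressed y - compressed x) <= f y - f x
    <= (derive1 f z + e) * (compressed y - compressed x).
  move=> xy; rewrite !ltr_distl => /andP[? ?] /andP[? ?].
  apply: increment_compressed => // v /andP[xv vy].
  have : `|derive1 f z - derive1 f v| <= e.
    have : `|z - v| < d by rewrite ltr_distl; apply/andP; split; lra.
    by move=> zv; apply: hd.
  by rewrite ler_distl => /andP[? ?]; apply/andP; split; lra.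
have zz : `|z - z| < d by rewrite subrr normr0.
have [lt_ts|lt_st|ets] := ltgtP t s; last by rewrite ets eqxx in st.
- have zw' : z < w by rewrite ltNge decompressed_le -ltNge.
  have := key _ _ zw' zz zw; rewrite !decompressedK => /andP[h1 h2].
  have st0 : 0 < s - t by rewrite subr_gt0.
  have : derive1 f z - e <= (f w - f z) / (s - t) <= derive1 f z + e.
    by rewrite ler_pdivlMr// ler_pdivrMr// h1 h2.
  rewrite (mulrC (s - t)^-1) distrC ler_distl.
  by move=> /andP[? ?]; apply/andP; split; lra.
- have zw' : w < z by rewrite ltNge decompressed_le -ltNge.
  have := key _ _ zw' zw zz; rewrite !decompressedK => /andP[h1 h2].
  have ts0 : 0 < t - s by rewrite subr_gt0.
  have -> : (s - t)^-1 * (f w - f z) = (f z - f w) / (t - s).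
    by rewrite -(opprB t s) invrN -(opprB (f z)) mulrNN mulrC.
  have : derive1 f z - e <= (f z - f w) / (t - s) <= derive1 f z + e.
    by rewrite ler_pdivlMr// ler_pdivrMr// h1 h2.
  rewrite distrC ler_distl.
  by move=> /andP[? ?]; apply/andP; split; lra.
Unshelve. all: by end_near.
Qed.

Local Notation Z := decompressed.

Lemma characteristic_decompressed (u : R * R -> R) :
  (forall t x, u (t, f x) = x) -> characteristic f u setT (f \o Z).
Proof.
move=> uf; split.
- split; first by move=> x y _ _ z _.
  by exists 0, 1; split => //; exact: ltr01.
- move=> t _; rewrite /= uf.
  by apply: cvg_within_filter; exact: decompressed_derive.
- apply: continuous_subspaceT => t /=.
  have -> : (fun t => f^`()%classic (u (t, f (Z t)))) = derive1 f \o Z.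
    by apply/funext => s; rewrite uf.
  by apply: continuous_comp; [exact: decompressed_continuous|exact: cf'].
Qed.

(** The neighbourhoods of radius [n.+1%:R^-1] decrease to the closed set [S] inside [[-1, 2]], so
    continuity of the measure from above applies. The uniform radius [e] puts every cell shorter
    than [e] that meets [S] into [A]. *)
Lemma critical_nbhd_measure (d : R) : 0 < d -> exists2 e : R, 0 < e &
  exists A : set R, [/\ measurable A, (mu A < +oo)%E,
    fine (mu A) < fine (mu S) + d &
    forall s x, S s -> `|s - x| < e -> A x].
Proof.
move=> d0.
pose O (n : nat) := \bigcup_(s in S) ball s (n.+1%:R^-1 : R).
have oO n : open (O n) by apply: bigcup_open => s _; exact: ball_open.
have mO n : measurable (O n) by exact: open_measurable.
have aux (a b c : R) : a - b < c -> c < a + b -> b <= 1 -> 0 <= c -> c <= 1 ->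
    -1 <= a <= 2.
  by move=> *; apply/andP; split; lra.
have Ole n : O n `<=` `[-1, 2].
  move=> x [s /S01/=]; rewrite in_itv/= => /andP[s0 s1].
  rewrite /ball/= ltr_distl => /andP[h1 h2].
  have : (n.+1%:R^-1 : R) <= 1 by rewrite invf_le1// ler1n.
  by rewrite in_itv/= => h3; exact: aux h1 h2 h3 s0 s1.
have Ofin n : (mu (O n) < +oo)%E.
  apply: (@le_lt_trans _ _ (mu `[-1, 2])).
    by apply: le_measure; rewrite ?inE//; exact: mO.
  by apply: compact_finite_measure; exact: segment_compact.
have capO : \bigcap_n O n = S.
  apply/seteqP; split=> [x xO|x Sx n _]; last first.
    by exists x => //; apply: ballxx; rewrite invr_gt0.
  apply: Sclosed => B /nbhs_ballP[e /= e0 eB].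
  have [n nE] : exists n : nat, n.+1%:R^-1 < e.
    exists (Num.truncn e^-1); rewrite invf_plt ?posrE//.
    exact: truncnS_gt.
  have [s Ss /= sx] := xO n I.
  exists s; split => //; apply: eB; apply: ball_sym.
  by apply: le_ball sx; exact: ltW.
have cv : mu (O n) @[n --> \oo] --> mu S.
  rewrite -capO; apply: nonincreasing_cvg_mu => //.
  - exact: Ofin.
  - exact: bigcapT_measurable.
  - apply/nonincreasing_seqP => n; apply/subsetPset => x [s Ss sx].
    exists s => //; apply: le_ball sx.
    by rewrite lef_pV2 ?posrE// ler_nat.
have Sfin : mu S \is a fin_num by rewrite ge0_fin_numE// critical_finite.
have : \forall n \near \oo, fine (mu (O n)) < fine (mu S) + d.
  have /fine_cvg : mu (O n) @[n --> \oo] --> (fine (mu S))%:E by rewrite fineK.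
  move=> /cvgrPdist_lt/(_ d d0); apply: filterS => n /=.
  by rewrite ltr_distl => /andP[]; rewrite ltrBlDr.
move=> [n _ /(_ n (leqnn n)) hn].
exists (n.+1%:R^-1); first by rewrite invr_gt0.
by exists (O n); split => // s x Ss sx; exists s.
Qed.

Hypothesis S_pos : (0 < mu S)%E.

(* The cells of a fine uniform partition that meet S have total length at least
   mu S, but their images under the compression have small total length. *)
Lemma decompressed_not_AC :
  ~ absolutely_continuous_itv (compressed (-1)) (compressed 1) Z.
Proof.
have m0 : 0 < fine (mu S) by rewrite fine_gt0// S_pos critical_finite.
(* The refuted tolerance is [mu S]: time intervals of total length below [d] will carry a
   displacement of at least [mu S]. *)
move=> /(_ _ m0) [d d0 hd].
have [e e0 [A [mA Aoo Ad hA]]] := critical_nbhd_measure d0.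
have SA : S `<=` A by move=> s Ss; apply: (hA s) => //; rewrite subrr normr0.
pose N := (Num.truncn (2 / e)).+1.
have Ngt0 : 0 < N%:R :> R by rewrite ltr0n.
have Ne : 2 / N%:R < e.
  by rewrite ltr_pdivrMr// mulrC -ltr_pdivrMr// truncnS_gt.
(* Nodes of a partition of [[-1, 1]] into [N] cells shorter than [e]. Starting at -1 keeps [S]
   strictly to the right of the first node. *)
pose x (i : nat) : R := -1 + i%:R * (2 / N%:R).
have w0 : 0 < 2 / N%:R :> R by rewrite divr_gt0.
have xS i : x i.+1 = x i + 2 / N%:R by rewrite /x -natr1 mulrDl mul1r addrA.
have x0 : x 0%N = -1 by rewrite /x mul0r addr0.
have xN : x N = 1.
  by rewrite /x mulrCA divff ?gt_eqF// mulr1; ring.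
have xle i j : (i <= j)%N -> x i <= x j.
  by move=> ij; rewrite lerD2l ler_wpM2r ?(ltW w0)// ler_nat.
pose K (i : nat) : bool := `[< exists2 s, S s & x i < s <= x i.+1 >].
pose a (i : 'I_N) := compressed (x i).
(* A cell that misses [S] gets the degenerate interval with [b i = a i]: the family stays indexed by
   all of ['I_N], and such cells add nothing to the sums. *)
pose b (i : 'I_N) := compressed (if K i then x i.+1 else x i).
have occ0 : occupation S (-1) = 0.
  rewrite /occupation (_ : S `&` _ = set0) ?measure0//.
  apply/seteqP; split => s //= -[/S01/=]; rewrite !in_itv/=; lra.
have occ1 : occupation S 1 = fine (mu S).
  rewrite /occupation (_ : S `&` _ = S)//.
  apply/seteqP; split => s //=; first by case.
  by move=> Ss; split => //; have := S01 Ss; rewrite /= !in_itv/=; lra.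
have totS : \sum_(i < N) (occupation S (x i.+1) - occupation S (x i)) = fine (mu S).
  by rewrite sum_occupationB xN x0 occ0 occ1 subr0.
have nK (i : nat) : ~~ K i -> occupation S (x i.+1) - occupation S (x i) = 0.
  move=> /asboolPn ni; rewrite occupationB ?critical_finite//; last exact: xle.
  rewrite (_ : S `&` _ = set0) ?measure0//.
  apply/seteqP; split => s //= -[Ss]; rewrite in_itv/= => xs; apply: ni.
  by exists s.
have KA (i : nat) : K i -> occupation A (x i.+1) - occupation A (x i) = 2 / N%:R.
  move=> /asboolP [s Ss /andP[xs sx]].
  rewrite occupationB_subset ?xle//; first by rewrite xS addrAC subrr add0r.
  move=> y /=; rewrite in_itv/= => /andP[xy yx]; apply: (hA s) => //.
  apply: le_lt_trans Ne; rewrite ler_distl; move: sx yx; rewrite xS => sx yx.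
  by apply/andP; split; lra.
have sumK : \sum_(i < N) (b i - a i) = \sum_(i < N | K i) (2 / N%:R) - fine (mu S).
  rewrite -totS [X in X - _]big_mkcond -sumrB; apply: eq_bigr => i _ /=.
  rewrite /a /b /compressed; case: ifPn => [_|/nK ->]; last by rewrite subrr subr0.
  by rewrite xS; ring.
(* Cells meeting [S] lie in [A], so their total length is at most [mu A], which is below
   [mu S + d]. *)
have leA : \sum_(i < N | K i) (2 / N%:R) <= fine (mu A).
  apply: (@le_trans _ _ (\sum_(i < N) (occupation A (x i.+1) - occupation A (x i)))).
    rewrite big_mkcond; apply: ler_sum => i _ /=.
    case: ifPn => [/KA ->//|_]; rewrite subr_ge0 occupation_homo//.
    exact: xle.
  rewrite sum_occupationB lerBlDr (le_trans (occupation_le _ mA Aoo))// lerDl.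
  exact: occupation_ge0.
have ab i : a i <= b i.
  by rewrite /a /b compressed_le; case: ifP => // _; exact: xle.
have zab (i : 'I_N) : Z (b i) - Z (a i) = if K i then 2 / N%:R else 0.
  rewrite /a /b !compressedK; case: ifP => _; last by rewrite subrr.
  by rewrite xS; ring.
have := hd N a b; apply/not_implyP; split.
  move=> i; split => //; rewrite /a /b compressed_le.
    by rewrite -x0 xle.
  by rewrite -xN; case: ifP => _; apply: xle; [exact: ltn_ord|exact/ltnW/ltn_ord].
apply/not_implyP; split.
  have disj (i j : 'I_N) : (i < j)%N -> b i <= a j.
    move=> ij; rewrite /a /b compressed_le; case: ifP => _; first exact: xle.
    by apply: xle; exact: ltnW.
  move=> i j _ _ [t []] /=; rewrite !in_itv/= => /andP[ait tbi] /andP[ajt tbj].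
  apply/val_inj => /=; have [ij|ji|//] := ssrnat.ltngtP (nat_of_ord i) (nat_of_ord j).
    by have := lt_le_trans tbi (disj _ _ ij); rewrite ltNge ltW.
  by have := lt_le_trans tbj (disj _ _ ji); rewrite ltNge ltW.
apply/not_implyP; split.
  by rewrite sumK ltrBlDr addrC (le_lt_trans leA).
apply/negP; rewrite -leNgt.
rewrite (eq_bigr (fun i : 'I_N => if K i then 2 / N%:R else 0)); last first.
  move=> i _; rewrite zab ger0_norm//.
  by case: ifP => // _; exact: ltW.
(* The displacement is the total length of the selected cells, and by [sumK] it exceeds [mu S] by
   the nonnegative sum of the [b i - a i]. *)
rewrite -big_mkcond/= -subr_ge0 -sumK sumr_ge0// => i _.
by rewrite subr_ge0.
Qed.

End CompressedTime.

Lemma lipschitz_AC (R : realType) (G : R) (a b : R) (I : set R) (h : R -> R) :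
  `[a, b] `<=` I -> G.-lipschitz_I h -> absolutely_continuous_itv a b h.
Proof.
move=> abI hG e e0.
have G0 : 0 < `|G| + 1 by rewrite ltr_wpDl.
exists (e / (`|G| + 1)); first by rewrite divr_gt0.
move=> n x y xy _ sxy.
apply: (@le_lt_trans _ _ (\sum_(i < n) (`|G| + 1) * (y i - x i))).
  apply: ler_sum => i _; have [ax xyi yb] := xy i.
  have inI t : x i <= t -> t <= y i -> I t.
    by move=> xt ty; apply: abI; rewrite /= in_itv/= (le_trans ax)// (le_trans ty).
  have := hG (y i, x i); rewrite /= => /(_ (conj (inI _ xyi (lexx _)) (inI _ (lexx _) xyi))).
  move=> /le_trans; apply.
  rewrite ger0_norm ?subr_ge0// ler_wpM2r ?subr_ge0//.
  by rewrite (le_trans (ler_norm _))// lerDl.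
by rewrite -mulr_sumr mulrC -ltr_pdivlMr.
Qed.

(** * The characteristics that stop at the critical set *)

Section StoppedMotion.
Variables (R : realType) (S : set R).
Implicit Types (a b s t w x y : R) (oa ob : option R).
Hypotheses (Sclosed : closed S) (S_neq0 : S !=set0).

(* The endpoints of the component of the complement of S around y; None stands
   for an infinite endpoint. *)
Definition gap_left y oa : Prop :=
  if oa is Some a then [/\ S a, a <= y & forall s, S s -> s <= y -> s <= a]
  else forall s, S s -> y < s.

Definition gap_right y ob : Prop :=
  if ob is Some b then [/\ S b, y <= b & forall s, S s -> y <= s -> b <= s]
  else forall s, S s -> s < y.

Lemma gap_left_ex y : exists oa, gap_left y oa.
Proof.
have [[s0 [Ss0 s0y]]|nex] := pselect (exists s, S s /\ s <= y); last first.
  exists None => s Ss /=; rewrite ltNge; apply/negP => sy.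
  by apply: nex; exists s.
pose A := S `&` [set s | s <= y].
have A0 : A !=set0 by exists s0.
have Ay : ubound A y by move=> s [].
have ubA : has_ubound A by exists y.
have clA : closed A by apply: closedI => //; exact: closed_le.
have [Sa ay] : A (sup A).
  by have := closure_sup A0 ubA; rewrite -(closure_id A).1.
exists (Some (sup A)); split=> // s Ss sy.
exact: ub_le_sup.
Qed.

Lemma gap_right_ex y : exists ob, gap_right y ob.
Proof.
have [[s0 [Ss0 s0y]]|nex] := pselect (exists s, S s /\ y <= s); last first.
  exists None => s Ss /=; rewrite ltNge; apply/negP => sy.
  by apply: nex; exists s.
pose A := S `&` [set s | y <= s].
have A0 : A !=set0 by exists s0.
have Ay : lbound A y by move=> s [].
have lbA : has_lbound A by exists y.
have clA : closed A by apply: closedI => //; exact: closed_ge.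
have [Sa ay] : A (inf A).
  rewrite [X in X _](_ : A = closure A); last exact/(closure_id A).1.
  move=> B /nbhs_ballP[e /= e0 eB].
  have [x Ax xe] := inf_adherent e0 (conj A0 lbA).
  exists x; split => //; apply: eB; rewrite /ball/= distrC ger0_norm.
    by rewrite ltrBlDl.
  by rewrite subr_ge0 ge_inf.
exists (Some (inf A)); split=> // s Ss sy.
exact: ge_inf.
Qed.

Lemma gap_left_uniq y oa ob : gap_left y oa -> gap_left y ob -> oa = ob.
Proof.
case: oa ob => [a|] [b|]//=.
- move=> [Sa ay ha] [Sb by_ hb]; congr Some; apply/eqP.
  by rewrite eq_le hb// ha.
- by move=> [Sa ay _] /(_ _ Sa); rewrite ltNge ay.
- by move=> h [Sa ay _]; move: (h _ Sa); rewrite ltNge ay.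
Qed.

Lemma gap_right_uniq y oa ob : gap_right y oa -> gap_right y ob -> oa = ob.
Proof.
case: oa ob => [a|] [b|]//=.
- move=> [Sa ay ha] [Sb by_ hb]; congr Some; apply/eqP.
  by rewrite eq_le hb// ha.
- by move=> [Sa ay _] /(_ _ Sa); rewrite ltNge ay.
- by move=> h [Sa ay _]; move: (h _ Sa); rewrite ltNge ay.
Qed.

Definition lower y := sval (cid (gap_left_ex y)).
Definition upper y := sval (cid (gap_right_ex y)).

Lemma lowerP y : gap_left y (lower y).
Proof. by rewrite /lower; case: cid. Qed.

Lemma upperP y : gap_right y (upper y).
Proof. by rewrite /upper; case: cid. Qed.

Definition above oa w := if oa is Some a then a < w else true.
Definition below ob w := if ob is Some b then w < b else true.

Definition clamp_left oa w := if oa is Some a then Num.max a w else w.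
Definition clamp_right ob w := if ob is Some b then Num.min b w else w.
(** The value 0 at an infinite endpoint drops that term from [phase]; the remaining logarithm alone
    maps a half-line gap onto the line. *)
Definition log_left oa y := if oa is Some a then ln (y - a) else 0.
Definition log_right ob y := if ob is Some b then ln (b - y) else 0.

(* phase restricts to an increasing bijection from each gap of S onto the line,
   so the parameters y of a gap give all the time shifts of one motion. *)
Definition phase y := log_left (lower y) y - log_right (upper y) y.

(* For a < b, max a w + min b w - w is the clamping of w to [a, b]; this form
   also covers infinite endpoints. *)
Definition stopped y t :=
  if pselect (S y) then y
  else clamp_left (lower y) (t + phase y) + clamp_right (upper y) (t + phase y)
       - (t + phase y).

Lemma stopped_in y t : S y -> stopped y t = y.
Proof. by rewrite /stopped; case: pselect. Qed.

Lemma stopped_notin y t : ~ S y -> stopped y t =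
  clamp_left (lower y) (t + phase y) + clamp_right (upper y) (t + phase y)
  - (t + phase y).
Proof. by rewrite /stopped; case: pselect. Qed.

Lemma above_self y : ~ S y -> above (lower y) y.
Proof.
move=> nSy; have := lowerP y; case: (lower y) => //= a [Sa ay _].
by rewrite lt_neqAle ay andbT; apply/eqP => e; apply: nSy; rewrite -e.
Qed.

Lemma below_self y : ~ S y -> below (upper y) y.
Proof.
move=> nSy; have := upperP y; case: (upper y) => //= a [Sa ay _].
by rewrite lt_neqAle ay andbT; apply/eqP => e; apply: nSy; rewrite e.
Qed.

(** No point of [S] lies strictly between the endpoints found around [y], so they also serve [w].
    Two infinite endpoints would leave no room for a point of [S]. *)
Lemma same_gap y w : ~ S y -> above (lower y) w -> below (upper y) w ->
  [/\ ~ S w, lower w = lower y & upper w = upper y].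
Proof.
move=> nSy aw bw.
have := lowerP y; have := upperP y.
case: (lower y) (upper y) aw bw (above_self nSy) (below_self nSy) => [a|] [b|] /=.
- move=> aw wb ay yb [Sb _ hb] [Sa _ ha].
  have key s : S s -> s <= a \/ b <= s.
    by move=> Ss; have [/ha|/ltW/hb] := leP s y; [left|right]; auto.
  split.
  + by move=> /key[|]; rewrite leNgt ?aw ?wb.
  + apply: (gap_left_uniq (lowerP w)); split=> // [|s /key[//|bs] sw]; first exact: ltW.
    by have := lt_le_trans wb (le_trans bs sw); rewrite ltxx.
  + apply: (gap_right_uniq (upperP w)); split=> // [|s /key[sa|//] ws]; first exact: ltW.
    by have := lt_le_trans aw (le_trans ws sa); rewrite ltxx.
- move=> aw _ ay _ hb [Sa _ ha].
  have key s : S s -> s <= a by move=> Ss; apply: ha => //; exact/ltW/hb.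
  split.
  + by move=> /key; rewrite leNgt aw.
  + apply: (gap_left_uniq (lowerP w)); split=> // [|s /key//]; exact: ltW.
  + by apply: (gap_right_uniq (upperP w)) => s /key sa; exact: le_lt_trans aw.
- move=> _ wb _ yb [Sb _ hb] ha.
  have key s : S s -> b <= s by move=> Ss; apply: hb => //; exact/ltW/ha.
  split.
  + by move=> /key; rewrite leNgt wb.
  + by apply: (gap_left_uniq (lowerP w)) => s /key sa; exact: lt_le_trans sa.
  + apply: (gap_right_uniq (upperP w)); split=> // [|s /key//]; exact: ltW.
- move=> _ _ _ _ hb ha; case: S_neq0 => s Ss.
  by have := lt_trans (hb _ Ss) (ha _ Ss); rewrite ltxx.
Qed.

Lemma lower_upper y : ~ S y ->
  if lower y is Some a then if upper y is Some b then a < b else true else true.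
Proof.
move=> nSy; have := above_self nSy; have := below_self nSy.
by case: (lower y) (upper y) => [a|] [b|]//= ? ?; apply: (@lt_trans _ _ y).
Qed.

Lemma stopped_lip y t t' : t <= t' -> 0 <= stopped y t' - stopped y t <= t' - t.
Proof.
move=> tt'; have [Sy|nSy] := pselect (S y).
  by rewrite !stopped_in// subrr lexx subr_ge0.
rewrite !stopped_notin//; have := lower_upper nSy.
case: (lower y) (upper y) => [a|] [b|]/=; rewrite ?maxEle ?minEle; move=> ab;
  repeat case: ifPn; rewrite -?ltNge => *; apply/andP; split; lra.
Qed.

Lemma stopped_dist y t t' : `|stopped y t' - stopped y t| <= `|t' - t|.
Proof.
have [/(stopped_lip y)|/ltW/(stopped_lip y)] := leP t t'.
  by move=> /andP[? ?]; rewrite !ger0_norm //; lra.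
by rewrite distrC (distrC t') => /andP[? ?]; rewrite !ger0_norm //; lra.
Qed.

(** Points of [S] are barriers that no path crosses. With [stopped_ge] this reduces monotonicity in
    [y] to a single gap. *)
Lemma stopped_le y s t : S s -> y <= s -> stopped y t <= s.
Proof.
move=> Ss ys; have [Sy|nSy] := pselect (S y); first by rewrite stopped_in.
rewrite !stopped_notin//; have := lower_upper nSy; have := upperP y.
case: (lower y) (upper y) => [a|] [b|]/=; rewrite ?maxEle ?minEle.
- move=> [_ _ /(_ _ Ss ys)]; repeat case: ifPn; rewrite -?ltNge => *; lra.
- by move=> /(_ _ Ss); rewrite ltNge ys.
- move=> [_ _ /(_ _ Ss ys)]; repeat case: ifPn; rewrite -?ltNge => *; lra.
- by move=> /(_ _ Ss); rewrite ltNge ys.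
Qed.

Lemma stopped_ge y s t : S s -> s <= y -> s <= stopped y t.
Proof.
move=> Ss ys; have [Sy|nSy] := pselect (S y); first by rewrite stopped_in.
rewrite !stopped_notin//; have := lower_upper nSy; have := lowerP y.
case: (lower y) (upper y) => [a|] [b|]/=; rewrite ?maxEle ?minEle.
- move=> [_ _ /(_ _ Ss ys)]; repeat case: ifPn; rewrite -?ltNge => *; lra.
- move=> [_ _ /(_ _ Ss ys)]; repeat case: ifPn; rewrite -?ltNge => *; lra.
- by move=> /(_ _ Ss); rewrite ltNge ys.
- by move=> /(_ _ Ss); rewrite ltNge ys.
Qed.

Lemma stopped_moving y t : ~ S y ->
  above (lower y) (t + phase y) -> below (upper y) (t + phase y) ->
  stopped y t = t + phase y.
Proof.
move=> nSy; rewrite stopped_notin//.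
case: (lower y) (upper y) => [a|] [b|]/=; rewrite ?maxEle ?minEle => h1 h2;
  rewrite ?(ltW h1) ?(leNgt b) ?h2/=; lra.
Qed.

(** Once [t + phase y] has left the open gap, the clamped value is an endpoint and hence a point of
    [S]. So the position alone tells whether the path moves, which is why a source can depend on
    position only. *)
Lemma stopped_notinP y t : ~ S y -> ~ S (stopped y t) <->
  above (lower y) (t + phase y) /\ below (upper y) (t + phase y).
Proof.
move=> nSy; split=> [nS|[h1 h2]]; last first.
  by rewrite stopped_moving//; have [] := same_gap nSy h1 h2.
move: nS; rewrite stopped_notin//.
have := lower_upper nSy; have := lowerP y; have := upperP y.
case: (lower y) (upper y) => [a|] [b|]/=; rewrite ?maxEle ?minEle.
- move=> [Sb _ _] [Sa _ _] ab nS; split; rewrite ltNge; apply/negP => h; apply: nS.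
    rewrite (_ : _ - _ = a)//.
    by repeat case: ifPn; rewrite -?ltNge => *; lra.
  rewrite (_ : _ - _ = b)//.
  by repeat case: ifPn; rewrite -?ltNge => *; lra.
- move=> _ [Sa _ _] _ nS; split=> //; rewrite ltNge; apply/negP => h; apply: nS.
  rewrite (_ : _ - _ = a)//.
  by repeat case: ifPn; rewrite -?ltNge => *; lra.
- move=> [Sb _ _] _ _ nS; split=> //; rewrite ltNge; apply/negP => h; apply: nS.
  rewrite (_ : _ - _ = b)//.
  by repeat case: ifPn; rewrite -?ltNge => *; lra.
- by [].
Qed.

(** Either a point of [S] between [y] and [y'] separates the two paths, or both labels lie in one
    gap, where [phase] is increasing and clamping is monotone. *)
Lemma stopped_homo t y y' : y <= y' -> stopped y t <= stopped y' t.
Proof.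
move=> yy'.
have [[s [Ss ys sy']]|nex] := pselect (exists s, [/\ S s, y <= s & s <= y']).
  by apply: (@le_trans _ _ s); [exact: stopped_le|exact: stopped_ge].
have nSy : ~ S y by move=> Sy; apply: nex; exists y.
have a' : above (lower y) y'.
  by have := above_self nSy; case: (lower y) => //= a /lt_le_trans; apply.
have b' : below (upper y) y'.
  have := upperP y; case: (upper y) => //= b [Sb yb _].
  by rewrite ltNge; apply/negP => by_; apply: nex; exists b.
have [nSy' el eu] := same_gap nSy a' b'.
rewrite !stopped_notin// /phase el eu.
have := lower_upper nSy.
have ll : log_left (lower y) y <= log_left (lower y) y'.
  have := above_self nSy; case: (lower y) a' => //= a ay' ay.
  by rewrite ler_ln ?posrE ?subr_gt0//; lra.
have lr : log_right (upper y) y' <= log_right (upper y) y.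
  have := below_self nSy; case: (upper y) b' => //= b ay' ay.
  by rewrite ler_ln ?posrE ?subr_gt0//; lra.
have : log_left (lower y) y - log_right (upper y) y <=
  log_left (lower y) y' - log_right (upper y) y' by lra.
move: (log_left _ y - _) (log_left _ y' - _) => p p'.
case: (lower y) (upper y) => [a|] [b|]/=; rewrite ?maxEle ?minEle; move=> pp' ab;
  repeat case: ifPn; rewrite -?ltNge => *; lra.
Qed.

Lemma stopped_surj t w : exists y, stopped y t = w.
Proof.
have [Sw|nSw] := pselect (S w); first by exists w; rewrite stopped_in.
(* A point off [S] is occupied only in motion, at position [t + phase y], so [phase y = w - t] has
   to be solved inside the gap of [w]. *)
suff [y [ay yb cE]] : exists y, [/\ above (lower w) y, below (upper w) y &
    log_left (lower w) y - log_right (upper w) y = w - t].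
  have [nSy el eu] := same_gap nSw ay yb.
  have ph : t + phase y = w by rewrite /phase el eu cE addrC subrK.
  exists y; rewrite stopped_moving ?ph// ?el ?eu.
    exact: above_self.
  exact: below_self.
set c := w - t; have e0 := expR_gt0 c.
have := lower_upper nSw; have := lowerP w; have := upperP w.
case: (lower w) (upper w) => [a|] [b|]/=.
- move=> _ _ ab; have d0 : 0 < 1 + expR c by rewrite addr_gt0.
  (* The solution of [ln ((y - a) / (b - y)) = c]. *)
  pose y := (a + b * expR c) / (1 + expR c).
  have yb : b - y = (b - a) / (1 + expR c) by rewrite /y; field; rewrite gt_eqF.
  have ya : y - a = expR c * (b - y) by rewrite yb /y; field; rewrite gt_eqF.
  have yb0 : 0 < b - y by rewrite yb divr_gt0// subr_gt0.
  exists y; split.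
  + by rewrite -subr_gt0 ya mulr_gt0.
  + by rewrite -subr_gt0.
  + by rewrite ya lnM ?posrE// expRK addrK.
- move=> _ _ _; exists (a + expR c); rewrite ltrDl; split => //.
  by rewrite addrAC subrr add0r expRK subr0.
- move=> _ _ _; exists (b - expR (- c)); rewrite ltrBlDr ltrDl expR_gt0; split => //.
  by rewrite subKr expRK sub0r opprK.
- move=> hb ha _; case: S_neq0 => s Ss.
  by have := lt_trans (hb _ Ss) (ha _ Ss); rewrite ltxx.
Qed.

(* A nondecreasing function onto the line is continuous, which gives continuity
   in y; the dependence on t is uniformly 1-Lipschitz. *)
Lemma stopped_continuous : continuous (fun p : R * R => stopped p.2 p.1).
Proof.
move=> [t y]; apply/cvgrPdist_lt => e e0.
have e2 : 0 < e / 2 by rewrite divr_gt0.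
have [y1 y1E] := stopped_surj t (stopped y t - e / 2).
have [y2 y2E] := stopped_surj t (stopped y t + e / 2).
have y1y : y1 < y.
  by rewrite ltNge; apply/negP => /(stopped_homo t); rewrite y1E; lra.
have yy2 : y < y2.
  by rewrite ltNge; apply/negP => /(stopped_homo t); rewrite y2E; lra.
exists (ball t (e / 2), `]y1, y2[%classic) => /=.
  split; first exact: nbhsx_ballx.
  by apply: near_in_itvoo; rewrite in_itv/= y1y.
move=> [t' y'] [/= tt']; rewrite in_itv/= => /andP[/ltW/(stopped_homo t) h1].
move=> /ltW/(stopped_homo t) h2.
have := stopped_dist y' t t'.
rewrite y1E in h1; rewrite y2E in h2.
move: tt'; rewrite /ball/= distrC => tt' /le_lt_trans/(_ tt').
by rewrite !ltr_distl => /andP[? ?]; apply/andP; split; lra.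
Qed.

End StoppedMotion.

Lemma difference_quotient (R : realType) (F : R -> R) (t d : R) :
  is_derive t 1 F d -> (s - t)^-1 * (F s - F t) @[s --> t^'] --> d.
Proof.
move=> [dF <-].
have cv : h^-1 *: ((F \o shift t) (h *: (1 : R)) - F t) @[h --> 0^'] --> 'D_1 F t.
  exact: dF.
apply/cvgrPdist_le => e e0; move/cvgrPdist_le : cv => /(_ e e0).
rewrite !near_withinE => /nbhs_ballP[r /= r0 hr].
near=> s => st.
have rs : `|0 - (s - t)| < r.
  by rewrite sub0r normrN distrC; near: s; exact: cvgr_dist_lt.
have := hr _ rs; rewrite subr_eq0 => /(_ st) /=.
by rewrite /GRing.scale/= mulr1 subrK.
Unshelve. all: by end_near.
Qed.

(** * The stopped paths as characteristics, and their source *)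

Section StoppedCharacteristics.
Variables (R : realType) (f finv : R -> R) (S : set R).
Local Notation mu := (@lebesgue_measure R).
Implicit Types (t w x y : R).
Hypotheses (df : forall x, derivable f x 1) (cf' : continuous (derive1 f)).
Hypotheses (f_inc : {homo f : x y / x < y}).
Hypotheses (fK : cancel f finv) (finvK : cancel finv f) (cfinv : continuous finv).
Hypotheses (SE : forall x, S x -> derive1 f x = 0).
Hypotheses (Sclosed : closed S) (S_neq0 : S !=set0).
Local Notation u := (fun p : R * R => finv p.2).
Local Notation z := (stopped Sclosed).
Local Notation chi' := (fun p : R * R => f (z p.2 p.1)).

Let cf : continuous f.
Proof. by move=> x; apply/differentiable_continuous/derivable1_diffP. Qed.

Lemma stopped_path_continuous y : continuous (z y).
Proof.
move=> t; apply/cvgrPdist_lt => e e0; near=> s.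
rewrite distrC; apply: le_lt_trans (stopped_dist Sclosed y t s) _.
by rewrite distrC; near: s; exact: cvgr_dist_lt.
Unshelve. all: by end_near.
Qed.

Lemma stopped_near_moving y t : ~ S (z y t) ->
  \forall s \near t, z y s = z y t + (s - t).
Proof.
move=> nS; have nSy : ~ S y by move=> Sy; apply: nS; rewrite stopped_in.
have [a b] := (stopped_notinP Sclosed S_neq0 t nSy).1 nS.
have na : \forall s \near t, above (lower Sclosed y) (s + phase Sclosed y).
  move: a; case: (lower _ _) => [a|] /=; last by move=> _; near=> s.
  rewrite -ltrBlDr => h; near=> s; rewrite -ltrBlDr; near: s; exact: lt_nbhsr.
have nb : \forall s \near t, below (upper Sclosed y) (s + phase Sclosed y).
  move: b; case: (upper _ _) => [b|] /=; last by move=> _; near=> s.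
  rewrite -ltrBrDr => h; near=> s; rewrite -ltrBrDr; near: s; exact: lt_nbhsl.
near=> s.
rewrite (stopped_moving nSy a b) stopped_moving//; [ring|near: s; exact: na|near: s; exact: nb].
Unshelve. all: by end_near.
Qed.

Lemma stopped_derive y t :
  (s - t)^-1 * (f (z y s) - f (z y t)) @[s --> t^'] --> derive1 f (z y t).
Proof.
have [Sz|nS] := pselect (S (z y t)); last first.
  have dz : is_derive t 1 (z y) 1.
    apply: (@near_eq_is_derive _ _ _ (fun s => z y t + (s - t))).
      near=> s; apply/esym; near: s; exact: stopped_near_moving.
    by apply: is_derive_eq; ring.
  have dfz : is_derive t 1 (f \o z y) (derive1 f (z y t) * 1).
    by apply: is_derive1_comp; rewrite derive1E; exact: derivableP.
  by rewrite mulr1 in dfz; exact: difference_quotient dfz.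
(* At a point of [S] the path may rest or have a kink, so [z y] need not be differentiable. But [f]
   has derivative 0 there and [z y] is 1-Lipschitz, so quotients over [s - t] are dominated by
   quotients over [z y s - z y t]. *)
rewrite SE//.
have : is_derive (z y t) 1 f 0 by rewrite -(SE Sz) derive1E; exact: derivableP.
move=> /difference_quotient/cvgrPdist_le hf; apply/cvgrPdist_le => e e0.
move: (hf _ e0); rewrite near_withinE => /nbhs_ballP[r /= r0 hr].
have /cvgrPdist_lt/(_ r r0) zc : z y s @[s --> t] --> z y t.
  exact: stopped_path_continuous.
near=> s.
have st : s != t by near: s; exact: nbhs_dnbhs_neq.
have zs : `|z y t - z y s| < r by near: s; apply: nbhs_dnbhs; exact: zc.
(* If the path has not moved there is no quotient in space to compare with, but then the increment
   of [f] is 0. *)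
have [->|zz] := eqVneq (z y s) (z y t); first by rewrite !subrr mulr0 subrr normr0 ltW.
have := hr _ zs zz; rewrite !sub0r !normrN !normrM !normfV => h.
have lip := stopped_dist Sclosed y t s.
apply: le_trans h; rewrite ler_wpM2r// lef_pV2// posrE normr_gt0 subr_eq0//.
Unshelve. all: by end_near.
Qed.

Lemma stopped_characteristic y : characteristic f u setT (fun t => chi' (t, y)).
Proof.
split.
- split; first by move=> ? ? _ _ ? _.
  by exists 0, 1; split => //; exact: ltr01.
- move=> t _ /=; rewrite fK; apply: cvg_within_filter; exact: stopped_derive.
- apply: continuous_subspaceT => /=.
  rewrite (_ : (fun _ => _) = derive1 f \o z y); last first.
    by apply/funext => t /=; rewrite fK.
  move=> t; apply: continuous_comp; last exact: cf'.
  exact: stopped_path_continuous.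
Qed.

Lemma stopped_parameterization : lagrangian_parameterization f u chi'.
Proof.
split.
- move=> p; apply: (@continuous_comp _ _ _ (fun p : R * R => z p.2 p.1) f).
    exact: stopped_continuous.
  exact: cf.
- exact: stopped_characteristic.
- move=> t y1 y2 y12; have := stopped_homo Sclosed S_neq0 t y12.
  by rewrite le_eqVlt => /predU1P[->//|/f_inc/ltW].
- move=> [t x] _; have [y yE] := stopped_surj Sclosed S_neq0 t (finv x).
  by exists (t, y) => //=; rewrite yE finvK.
Qed.

Lemma stopped_includes x : (f @` S) x -> includes chi' (fun=> x).
Proof.
move=> [s Ss <-]; exists s; apply/funext => t /=.
by rewrite stopped_in.
Qed.

Definition moving_source (p : R * R) : R := \1_(~` S) (finv p.2).

Lemma bounded_borel_moving_source : bounded_borel moving_source.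
Proof.
split; last first.
  by exists 1 => p; rewrite /moving_source indicE ger0_norm//; case: (_ \in _).
have m1 : measurable_fun [set: measurableTypeR R] ((\1_(~` S) : R -> R) \o finv).
  apply: measurableT_comp; last exact: continuous_measurable_fun.
  by apply: measurable_indic; apply: measurableC; exact: closed_measurable.
exact: (measurableT_comp m1 measurable_snd).
Qed.

Lemma clamp_left_derivative oa (th : R) :
  continuous (fun t => clamp_left oa (t + th)) /\
  exists h : R -> R, [/\ measurable_fun setT h, forall t, `|h t| <= 1,
    forall t, h t = (above oa (t + th))%:R &
    distributional_derivative (fun t => clamp_left oa (t + th)) h].
Proof.
case: oa => [a|] /=; last first.
  have ct : continuous (fun t => t + th).
    by move=> t; apply: cvgD; [exact: cvg_id|exact: cvg_cst].
  split=> //; exists (cst 1); split => //.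
    by move=> t; rewrite normr1.
  (* There is no kink: both branches coincide and the breakpoint 0 is arbitrary. *)
  apply: (@distributional_derivative_piecewise _ 1 th 1 th 0 1) => //.
  - by move=> t; rewrite normr1.
  - by move=> t _; rewrite mul1r.
  - by move=> t _; rewrite mul1r.
have ct : continuous (fun t => Num.max a (t + th)).
  move=> t; apply: (@continuous_comp _ _ _ (fun t => t + th) (fun w => Num.max a w)).
    by apply: cvgD; [exact: cvg_id|exact: cvg_cst].
  by apply: continuous_max => ?; [exact: cvg_cst|exact: cvg_id].
split=> //.
have hE t : \1_(`]a - th, +oo[%classic) t = (a < t + th)%R%:R :> R.
  rewrite indicE; congr (_%:R); congr nat_of_bool.
  by apply/idP/idP; rewrite inE/= in_itv/= andbT ltrBlDr.
exists (\1_(`]a - th, +oo[%classic)); split => //.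
- by move=> t; rewrite indicE ger0_norm//; case: (_ \in _).
- apply: (@distributional_derivative_piecewise _ 0 a 1 th (a - th) 1) => //.
  + by move=> t; rewrite indicE ger0_norm//; case: (_ \in _).
  + by move=> t; rewrite lerBrDr mul0r add0r => h; apply/max_idPl.
  + by move=> t; rewrite lerBlDr mul1r => h; apply/max_idPr.
  + by move=> t h; rewrite hE -ltrBlDr ltNge ltW.
  + by move=> t h; rewrite hE -ltrBlDr h.
Qed.

Lemma clamp_right_derivative ob (th : R) :
  continuous (fun t => clamp_right ob (t + th)) /\
  exists h : R -> R, [/\ measurable_fun setT h, forall t, `|h t| <= 1,
    forall t, h t = (below ob (t + th))%:R &
    distributional_derivative (fun t => clamp_right ob (t + th)) h].
Proof.
case: ob => [b|]; last first.
  by have [ct [h [? ? hE ?]]] := clamp_left_derivative None th; split=> //; exists h.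
rewrite /=.
have ct : continuous (fun t => Num.min b (t + th)).
  move=> t; apply: (@continuous_comp _ _ _ (fun t => t + th) (fun w => Num.min b w)).
    by apply: cvgD; [exact: cvg_id|exact: cvg_cst].
  by apply: continuous_min => ?; [exact: cvg_cst|exact: cvg_id].
split=> //.
have hE t : \1_(`]-oo, b - th[%classic) t = (t + th < b)%R%:R :> R.
  rewrite indicE; congr (_%:R); congr nat_of_bool.
  by apply/idP/idP; rewrite inE/= in_itv/= ltrBrDr.
exists (\1_(`]-oo, b - th[%classic)); split => //.
- by move=> t; rewrite indicE ger0_norm//; case: (_ \in _).
- apply: (@distributional_derivative_piecewise _ 1 th 0 b (b - th) 1) => //.
  + by move=> t; rewrite indicE ger0_norm//; case: (_ \in _).
  + by move=> t; rewrite lerBrDr mul1r => h; apply/min_idPr.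
  + by move=> t; rewrite lerBlDr mul0r add0r => h; apply/min_idPl.
  + by move=> t h; rewrite hE -ltrBrDr h.
  + by move=> t h; rewrite hE -ltrBrDr ltNge ltW.
Qed.

Lemma stopped_source : lagrangian_source u chi' moving_source.
Proof.
split=> [|y]; first exact: bounded_borel_moving_source.
have -> : (fun t => finv (t, chi' (t, y)).2) = z y.
  by apply/funext => t /=; rewrite fK.
rewrite (_ : (fun t => _) = fun t => \1_(~` S) (z y t)); last first.
  by apply/funext => t; rewrite /moving_source /= fK.
have [Sy|nSy] := pselect (S y).
  have -> : z y = cst y by apply/funext => t; rewrite stopped_in.
  have -> : (fun t => \1_(~` S) (cst y t)) = cst 0 :> (R -> R).
    by apply/funext => t /=; rewrite indicE memNset.
  apply: (@distributional_derivative_piecewise _ 0 y 0 y 0 0) => //.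
  - by move=> t; exact: cst_continuous.
  - by move=> t; rewrite normr0.
  - by move=> t _; rewrite mul0r add0r.
  - by move=> t _; rewrite mul0r add0r.
set th := phase Sclosed y.
have [c1 [h1 [m1 b1 e1 d1]]] := clamp_left_derivative (lower Sclosed y) th.
have [c2 [h2 [m2 b2 e2 d2]]] := clamp_right_derivative (upper Sclosed y) th.
have [c3 [h3 [m3 b3 e3 d3]]] := clamp_left_derivative None th.
have := distributional_derivativeDB c1 c2 c3 m1 m2 m3 b1 b2 b3 d1 d2 d3.
congr distributional_derivative; apply/funext => t.
  by rewrite stopped_notin.
rewrite e1 e2 e3 /= indicE.
have := stopped_notinP Sclosed S_neq0 t nSy; rewrite -/th => nP.
have [[a b]|nab] := pselect (above (lower Sclosed y) (t + th) /\
    below (upper Sclosed y) (t + th)).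
  by rewrite mem_set; [rewrite a b addrK|apply/nP].
rewrite memNset; last by move=> /nP.
(* While the path rests, exactly one of [above] and [below] holds, because the left endpoint
   precedes the right one; subtracting the constant 1 leaves 0. *)
have := lower_upper Sclosed nSy.
move: nab; case: (lower _ _) (upper _ _) => [a|] [b|] //=.
- move=> nab ab; have [h|h] := ltP a (t + th).
    have -> : (t + th < b) = false by apply/negP => h'; apply: nab.
    by rewrite addr0 subrr.
  have -> : t + th < b by exact: le_lt_trans ab.
  by rewrite add0r subrr.
- move=> nab _; have -> : (a < t + th) = false by apply/negP => h'; apply: nab.
  by rewrite add0r subrr.
- move=> nab _; have -> : (t + th < b) = false by apply/negP => h'; apply: nab.
  by rewrite addr0 subrr.
- by move=> nab; case: nab.
Qed.

End StoppedCharacteristics.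

(** * Integration on the plane *)

Section Plane.
Variable R : realType.
Local Notation mu := (@lebesgue_measure R).
Local Notation mu2 := (@lebesgue_measure2 R).
Local Notation RR := (measurableTypeR R * measurableTypeR R)%type.

Lemma rat_near (x r : R) : 0 < r -> exists q : rat, `|ratr q - x| < r.
Proof.
move=> r0; have [|q] := @rat_in_itvoo _ (x - r) (x + r); first by lra.
by rewrite in_itv/= => ?; exists q; rewrite ltr_distl.
Qed.

(** Countably many rational boxes fill an open set, and boxes belong to the product sigma-algebra.
    This is what makes continuous functions on the plane measurable for it. *)
Lemma open_measurable2 (U : set (R * R)) : open U -> measurable (U : set RR).
Proof.
move=> oU.
have aux (a b c i e : R) : `|a - b| < i -> `|a - c| < i -> i < e / 2 -> `|b - c| < e.
  rewrite !ltr_distl => /andP[? ?] /andP[? ?] ?; apply/andP; split; lra.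
pose box (q1 q2 : rat) (n : nat) : set RR :=
  (ball (ratr q1 : R) n.+1%:R^-1) `*` (ball (ratr q2 : R) n.+1%:R^-1).
(* Boxes that leave [U] are replaced by the empty set, so that the union can run over all rational
   centres and all radii. *)
pose B q1 q2 n : set RR := if `[< box q1 q2 n `<=` U >] then box q1 q2 n else set0.
have -> : U = \bigcup_q1 \bigcup_q2 \bigcup_n B q1 q2 n.
  apply/seteqP; split=> [p Up|p [q1 _ [q2 _ [n _]]]]; last first.
    by rewrite /B; case: asboolP => // h /h.
  have /nbhs_ballP[e /= e0 eU] : nbhs p U by exact: open_nbhs_nbhs.
  have [n nE] : exists n : nat, n.+1%:R^-1 < e / 2 :> R.
    exists (Num.truncn (e / 2)^-1); rewrite invf_plt ?posrE ?divr_gt0//.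
    exact: truncnS_gt.
  have i0 : 0 < n.+1%:R^-1 :> R by rewrite invr_gt0.
  have [q1 q1P] := rat_near p.1 i0.
  have [q2 q2P] := rat_near p.2 i0.
  exists q1 => //; exists q2 => //; exists n => //.
  rewrite /B; case: asboolP => [_|]; first by split.
  case=> r [] /= h1 h2; apply: eU; split => /=.
    exact: aux q1P h1 nE.
  exact: aux q2P h2 nE.
apply: bigcupT_measurable_rat => q1; apply: bigcupT_measurable_rat => q2.
apply: bigcupT_measurable => n; rewrite /B; case: asboolP => _ //.
by apply: measurableX; apply: open_measurable; exact: ball_open.
Qed.

Lemma continuous_measurable2 (F : R * R -> R) : continuous F ->
  measurable_fun [set: RR] F.
Proof.
move=> cF mD; apply: (measurability _ (RGenOInfty.measurableE R)) => //.
move=> _ [_ [a ->] <-]; rewrite setTI; apply: open_measurable2.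
have -> : F @^-1` `]a, +oo[ = F @^-1` [set y | a < y].
  by apply/seteqP; split => p /=; rewrite in_itv/= andbT.
by apply: open_comp => [? _|]; [exact: cF|exact: open_gt].
Qed.

Lemma integrable2_continuous_support (F : R * R -> R) (M : R) : continuous F ->
  (forall p, M <= `|p.1| \/ M <= `|p.2| -> F p = 0) ->
  mu2.-integrable [set: RR] (EFin \o F).
Proof.
move=> cF F0.
pose A : set RR := `[- M, M] `*` `[- M, M].
have mA : measurable A by exact: measurableX.
have FE : EFin \o F = (EFin \o F) \_ A.
  apply/funext => p; rewrite /patch; case: ifPn => //.
  rewrite notin_setE /A/= !in_itv/= -!ler_norml => nA.
  rewrite F0//; apply: contrapT => /not_orP[/negP h1 /negP h2]; apply: nA.
  by rewrite -!ltNge in h1 h2; rewrite !ltW.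
rewrite FE; apply/integrable_restrict => //; rewrite setTI.
have cA : compact (A : set (R * R)) by apply: compact_setX; exact: segment_compact.
apply: measurable_bounded_integrable => //.
- rewrite /lebesgue_measure2/= product_measure1E//.
  have fin : (mu `[(- M)%R, M] < +oo)%E.
    by apply: compact_finite_measure; exact: segment_compact.
  by rewrite lte_mul_pinfty// ge0_fin_numE.
- apply: measurable_funS (continuous_measurable2 cF) => //.
- have /compact_bounded[N [Nr hN]] :=
    continuous_compact (continuous_subspaceT cF : {within (A : set (R * R)), continuous F}) cA.
  exists N; split => // x Nx p Ap; apply: hN Nx _ _.
  by exists p.
Qed.

(** Both terms stay under one extended-real integral, the form of the inner integral that Fubini
    produces. *)
Lemma integral_parts_support (a b M : R) (phi : R -> R) :
  (forall x, derivable phi x 1) -> continuous (derive1 phi) -> 0 < M ->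
  (forall x, M <= `|x| -> phi x = 0 /\ derive1 phi x = 0) ->
  (\int[mu]_t ((a * t + b) * derive1 phi t + a * phi t)%:E = 0)%E.
Proof.
move=> dphi cphi' M0 hM.
have cphi : continuous phi.
  by move=> x; apply/differentiable_continuous/derivable1_diffP/dphi.
have caff : continuous (fun t : R => a * t + b).
  move=> t; apply: cvgD; last exact: cvg_cst.
  by apply: cvgM; [exact: cvg_cst|exact: cvg_id].
have i1 : mu.-integrable setT (EFin \o (fun t => (a * t + b) * derive1 phi t)).
  apply: (@integrable_continuous_support _ _ M).
    by move=> t; apply: cvgM; [exact: caff|exact: cphi'].
  by move=> t /hM[_ ->]; rewrite mulr0.
have i2 : mu.-integrable setT (EFin \o (fun t => a * phi t)).
  apply: (@integrable_continuous_support _ _ M).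
    by move=> t; apply: cvgM; [exact: cvg_cst|exact: cphi].
  by move=> t /hM[-> _]; rewrite mulr0.
have i12 : mu.-integrable setT
    (EFin \o (fun t => (a * t + b) * derive1 phi t + a * phi t)).
  exact: (integrableD measurableT i1 i2).
rewrite -[LHS]fineK; last exact: integrable_fin_num i12.
congr EFin; have := RintegralD measurableT i1 i2; rewrite /Rintegral => ->.
have := Rintegral_affine_support a b dphi cphi' M0 hM; rewrite /Rintegral => ->.
by rewrite addNr.
Qed.

Lemma partial_t_slice (psi : R * R -> R) (t x : R) :
  derivable psi (t, x) (e_t R) ->
  derivable (fun s => psi (s, x)) t 1 /\
  derive1 (fun s => psi (s, x)) t = 'D_(e_t R) psi (t, x).
Proof.
have E : (fun h : R => h^-1 *: ((psi \o shift (t, x)) (h *: e_t R) - psi (t, x))) =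
  (fun h : R => h^-1 *: (((fun s => psi (s, x)) \o shift t) (h *: (1 : R)) - psi (t, x))).
  apply/funext => h; congr (_ *: (psi _ - _)).
  by rewrite /e_t /=; congr pair; rewrite /= /GRing.scale/= mulr0 add0r.
by rewrite derive1E /derivable /derive E.
Qed.

Lemma partial_x_slice (psi : R * R -> R) (t x : R) :
  derivable psi (t, x) (e_x R) ->
  derivable (fun s => psi (t, s)) x 1 /\
  derive1 (fun s => psi (t, s)) x = 'D_(e_x R) psi (t, x).
Proof.
have E : (fun h : R => h^-1 *: ((psi \o shift (t, x)) (h *: e_x R) - psi (t, x))) =
  (fun h : R => h^-1 *: (((fun s => psi (t, s)) \o shift x) (h *: (1 : R)) - psi (t, x))).
  apply/funext => h; congr (_ *: (psi _ - _)).
  by rewrite /e_x /=; congr pair; rewrite /= /GRing.scale/= mulr0 add0r.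
by rewrite derive1E /derivable /derive E.
Qed.

Lemma test_function2_support (psi : R * R -> R) : test_function2 psi ->
  exists2 M, 0 < M & forall p, M <= `|p.1| \/ M <= `|p.2| ->
    [/\ psi p = 0, 'D_(e_t R) psi p = 0 & 'D_(e_x R) psi p = 0].
Proof.
move=> [sm /compact_bounded [M [_ hM]]].
have out p : `|M| + 1 <= `|p.1| \/ `|M| + 1 <= `|p.2| -> psi p = 0.
  move=> pM; apply/eqP; apply/negPn/negP => psip.
  have : `|p| <= `|M| + 1 / 2.
    apply: hM; last exact: subset_closure.
    by rewrite (le_lt_trans (ler_norm _))// ltrDl.
  rewrite prod_normE/= ge_max => /andP[h1 h2].
  by case: pM => ?; lra.
have dd p := (sm [::] (fun _ => ltac:(by []))).2 p.
exists (`|M| + 2) => [|[t x] /= pM]; first by rewrite ltr_wpDl.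
have [d1 d2] := dd (t, x).
have [_ <-] := partial_t_slice d1; have [_ <-] := partial_x_slice d2.
split.
- by apply: out => /=; case: pM => ?; [left|right]; lra.
- case: pM => h.
    apply: (@derive1_near0 _ _ (`|M| + 1)); last by lra.
    by move=> s hs; apply: out; left.
  rewrite (_ : (fun s => psi (s, x)) = cst 0) ?derive1_cst//.
  by apply/funext => s; apply: out; right => /=; lra.
- case: pM => h.
    rewrite (_ : (fun s => psi (t, s)) = cst 0) ?derive1_cst//.
    by apply/funext => s; apply: out; left => /=; lra.
  apply: (@derive1_near0 _ _ (`|M| + 1)); last by lra.
  by move=> s hs; apply: out; right.
Qed.

(** Here [f (u p) = p.2] and [u] does not depend on time, so Fubini reduces the law to lines: for
    fixed [x] the integral of [psi_t] in time is 0, and for fixed [t] that of [x * psi_x + psi] in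
    space is 0. *)
Lemma balance_law_inverse (f finv : R -> R) : cancel finv f -> continuous finv ->
  distributional_balance_law f (fun p => finv p.2) (fun=> 1).
Proof.
move=> finvK cfinv psi tpsi; have [M M0 hM] := test_function2_support tpsi.
have [sm _] := tpsi.
have [cpsi dpsi] := sm [::] (fun _ => ltac:(by [])).
have [cdt _] := sm [:: e_t R] ltac:(by move=> e; rewrite !inE => /eqP ->; rewrite eqxx).
have [cdx _] := sm [:: e_x R] ltac:(by move=> e; rewrite !inE => /eqP ->; rewrite eqxx orbT).
rewrite /= in cpsi dpsi cdt cdx.
have csnd (k : R -> R) : continuous k -> continuous (fun p : R * R => k p.2).
  by move=> ck p; apply: continuous_comp; [exact: cvg_snd|exact: ck].
have i1 : mu2.-integrable [set: RR] (EFin \o (fun p => finv p.2 * 'D_(e_t R) psi p)).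
  apply: (@integrable2_continuous_support _ M).
    by move=> p; apply: cvgM; [exact: csnd|exact: cdt].
  by move=> p /hM[_ -> _]; rewrite mulr0.
have i2 : mu2.-integrable [set: RR] (EFin \o (fun p => p.2 * 'D_(e_x R) psi p)).
  apply: (@integrable2_continuous_support _ M).
    by move=> p; apply: cvgM; [exact: cvg_snd|exact: cdx].
  by move=> p /hM[_ _ ->]; rewrite mulr0.
have i3 : mu2.-integrable [set: RR] (EFin \o (fun p => 1 * psi p)).
  apply: (@integrable2_continuous_support _ M).
    by move=> p; apply: cvgM; [exact: cvg_cst|exact: cpsi].
  by move=> p /hM[-> _ _]; rewrite mulr0.
have slice_t (x : R) : continuous (fun t : R => (t, x)).
  move=> t; apply/cvgrPdist_lt => e e0; near=> s.
  rewrite prod_normE/= subrr normr0 gt_max e0 andbT; near: s; exact: cvgr_dist_lt.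
have slice_x (t : R) : continuous (fun x : R => (t, x)).
  move=> x; apply/cvgrPdist_lt => e e0; near=> s.
  rewrite prod_normE/= subrr normr0 gt_max e0; near: s; exact: cvgr_dist_lt.
have I1 : \int[mu2]_p (finv p.2 * 'D_(e_t R) psi p) = 0.
  rewrite /Rintegral -(integral21_prod_meas1 i1).
  rewrite (_ : fubini_G _ _ = cst 0%E) ?integral0//.
  apply/funext => x; rewrite /fubini_G /=.
  have dE : derive1 (fun t => psi (t, x)) = (fun t => 'D_(e_t R) psi (t, x)).
    by apply/funext => t; have [] := partial_t_slice (dpsi (t, x)).1.
  rewrite -[RHS](@integral_parts_support 0 (finv x) M (fun t => psi (t, x))).
  - by apply: eq_integral => t _; rewrite dE !mul0r add0r addr0.
  - by move=> t; have [] := partial_t_slice (dpsi (t, x)).1.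
  - rewrite dE => t; apply: (@continuous_comp _ _ _ (fun t : R => (t, x)) ('D_(e_t R) psi)).
      exact: slice_t.
    exact: cdt.
  - exact: M0.
  - by move=> t tM; rewrite dE; have [] := hM (t, x) (or_introl tM).
have I2 : \int[mu2]_p (p.2 * 'D_(e_x R) psi p + 1 * psi p) = 0.
  have i23 : mu2.-integrable [set: RR]
      (EFin \o (fun p => p.2 * 'D_(e_x R) psi p + 1 * psi p)).
    exact: (integrableD measurableT i2 i3).
  rewrite /Rintegral -(integral12_prod_meas1 i23).
  rewrite (_ : fubini_F _ _ = cst 0%E) ?integral0//.
  apply/funext => t; rewrite /fubini_F /=.
  have dE : derive1 (fun x => psi (t, x)) = (fun x => 'D_(e_x R) psi (t, x)).
    by apply/funext => x; have [] := partial_x_slice (dpsi (t, x)).2.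
  rewrite -[RHS](@integral_parts_support 1 0 M (fun x => psi (t, x))).
  - by apply: eq_integral => x _; rewrite dE !mul1r addr0.
  - by move=> x; have [] := partial_x_slice (dpsi (t, x)).2.
  - rewrite dE => x; apply: (@continuous_comp _ _ _ (fun x : R => (t, x)) ('D_(e_x R) psi)).
      exact: slice_x.
    exact: cdx.
  - exact: M0.
  - by move=> x xM; rewrite dE; have [] := hM (t, x) (or_intror xM).
rewrite I1 oppr0 add0r.
under eq_Rintegral do rewrite finvK.
move: I2; rewrite RintegralD//= => /eqP; rewrite addrC addr_eq0 => /eqP ->.
by [].
Unshelve. all: by end_near.
Qed.

Lemma lebesgue_measure_translate (A : set R) (c : R) : measurable A ->
  mu ((fun z => z + c) @^-1` A) = mu A.
Proof.
move=> mA.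
have mf : measurable_fun [set: measurableTypeR R] (fun z : R => z + c).
  by apply: continuous_measurable_fun => z; apply: cvgD; [exact: cvg_id|exact: cvg_cst].
pose m' : {measure set (measurableTypeR R) -> \bar R} :=
  @measure_function_pushforward__canonical__measure_function_Measure
    _ _ (measurableTypeR R) (measurableTypeR R) _ mu (fun z : R => z + c) mf.
suff h : forall X, ocitv X -> mu X = m' X.
  by rewrite (lebesgue_measure_unique h mA).
move=> _ [[a b] _ <-]; rewrite /m'/= /pushforward.
have -> : (fun z => z + c) @^-1` `]a, b] = `]a - c, b - c]%classic.
  by apply/seteqP; split => z /=; rewrite !in_itv/= ltrBlDr lerBrDr.
rewrite !lebesgue_measure_itv/= !lte_fin ltrD2r; case: ifP => // _.
by rewrite -!EFinB; congr EFin; ring.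
Qed.

Lemma integral_eq0_ae (F : R -> \bar R) : measurable_fun [set: measurableTypeR R] F ->
  (forall x, 0 <= F x)%E -> (\int[mu]_x F x = 0)%E ->
  {ae mu, forall x, F x = 0%E}.
Proof.
move=> mF F0 iF.
have : ae_eq mu setT F (cst 0%E).
  apply/ae_eq_integral_abs => //; rewrite -[RHS]iF.
  by apply: eq_integral => x _; rewrite gee0_abs.
by apply: filterS => x /(_ I).
Qed.

Lemma product_null_xsection (N : set RR) : measurable N -> mu2 N = 0%E ->
  {ae mu, forall t, mu (xsection N t) = 0%E}.
Proof.
move=> mN N0; apply: integral_eq0_ae => //.
exact: (measurable_fun_xsection mu mN).
Qed.

(** The measure is built by integrating x-sections; uniqueness of the product measure allows the
    other order. *)
Lemma product_null_ysection (N : set RR) : measurable N ->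
  (forall z, mu (ysection N z) = 0%E) -> mu2 N = 0%E.
Proof.
move=> mN N0.
have -> : mu2 N = (mu \x^ mu)%E N.
  by apply: product_measure_unique => // A B mA mB; exact: product_measure2E.
rewrite /product_measure2.
by rewrite (eq_integral (cst 0%E)) ?integral0// => z _ /=; rewrite N0.
Qed.

(* The source vanishes almost everywhere on the set of the (t, f s), s in S, by
   Fubini, and is 1 there after the shear (t, tau) |-> (t, t + tau). *)
Lemma no_common_source (f : R -> R) (S : set R) (g : R * R -> R) :
  continuous f -> measurable S -> (0 < mu S)%E ->
  measurable_fun [set: RR] g ->
  {ae mu2, forall p, g (p.1, f (p.1 + p.2)) = 1} ->
  (forall s, S s -> {ae mu, forall t, g (t, f s) = 0}) -> False.
Proof.
move=> cf mS S_pos mg [N [mN N0 gN]] g0.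
pose G (p : RR) : R := g (p.1, f p.2).
have mG : measurable_fun [set: RR] G.
  apply: (measurableT_comp mg); apply: measurable_fun_pair; first exact: measurable_fst.
  by apply: measurableT_comp; [exact: continuous_measurable_fun|exact: measurable_snd].
(* The points over [S] where the source is nonzero, in the coordinates [(t, z)]. The section at a
   given [z] is null by hypothesis if [z] is in [S], and empty otherwise. *)
pose E : set RR := [set p | S p.2] `&` (G @^-1` (~` [set 0])).
have mE : measurable E.
  apply: measurableI.
    by rewrite -[X in measurable X]setTI; apply: measurable_snd.
  rewrite -[X in measurable X]setTI; apply: mG => //.
  by apply: measurableC; exact: measurable_set1.
have E0 : mu2 E = 0%E.
  apply: product_null_ysection => // z.
  have mEz : measurable (ysection E z) by exact: measurable_ysection.
  have [Sz|nSz] := pselect (S z); last first.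
    rewrite (_ : ysection E z = set0) ?measure0//.
    by apply/seteqP; split => t //; rewrite /ysection /= inE => -[].
  apply: measure_negligible => //.
  have := g0 z Sz; apply: negligibleS => t.
  by rewrite /ysection /= inE => -[_ /=].
have sE := product_null_xsection mE E0.
have sN := product_null_xsection mN N0.
(* One time at which both exceptional sets have null sections is enough; it exists because [[0, 1]]
   is not null. *)
have [t [tE tN]] : exists t, mu (xsection E t) = 0%E /\ mu (xsection N t) = 0%E.
  have : {ae mu, forall t, mu (xsection E t) = 0%E /\ mu (xsection N t) = 0%E}.
    have fF := ae_filter_ringOfSetsType mu.
    by apply: filterS2 sE sN => t.
  move=> [Z [mZ Z0 hZ]]; apply: contrapT => /forallNP h.
  have : (mu `[0%R, 1%R] <= mu Z)%E.
    by apply: le_measure; rewrite ?inE// => t _; apply: hZ; exact: h.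
  by rewrite Z0 lebesgue_measure_itv/= lte_fin ltr01 oppr0 addr0 lee_fin ler10.
have mNt : measurable (xsection N t) by exact: measurable_xsection.
have mEt : measurable (xsection E t) by exact: measurable_xsection.
(* The exceptional [tau] at time [t], carried to the position [z = t + tau]; translation keeps the
   set null. *)
pose T := (fun z => z + - t) @^-1` (xsection N t).
have mT : measurable T.
  rewrite -[T]setTI; suff : measurable_fun [set: measurableTypeR R] (fun z : R => z + - t).
    by apply.
  by apply: continuous_measurable_fun => z; apply: cvgD; [exact: cvg_id|exact: cvg_cst].
have T0 : mu T = 0%E by rewrite lebesgue_measure_translate.
(* At a point of [S] outside both null sets, [g (t, f z)] would equal 0 and 1 at once. *)
have sub : S `<=` xsection E t `|` T.
  move=> z Sz; have [g0z|g0z] := pselect (g (t, f z) = 0); last first.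
    by left; rewrite /xsection /= inE.
  right; rewrite /T /xsection /= inE; apply: gN => /=.
  by rewrite addrCA subrr addr0 g0z => /eqP; rewrite eq_sym oner_eq0.
have : (mu S <= mu (xsection E t) + mu T)%E.
  apply: le_trans (measureU2 _ mEt mT); apply: le_measure; rewrite ?inE//.
  exact: measurableU.
by rewrite tE T0 addr0 leNgt S_pos.
Qed.

End Plane.

(** * Sources along translations and verticals *)

Section Inverse.
Variables (R : realType) (f finv : R -> R).
Hypotheses (f_inc : {homo f : x y / x < y}) (finvK : cancel finv f).

Lemma increasing_inverse_continuous : continuous finv.
Proof.
move=> x; apply/cvgrPdist_lt => e e0.
have f_le (a b : R) : f a < f b -> a < b.
  by apply: contraTT; rewrite -!leNgt le_eqVlt => /predU1P[->//|/f_inc/ltW].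
have lo : f (finv x - e) < x by rewrite -[ltRHS]finvK f_inc// ltrBlDr ltrDl.
have hi : x < f (finv x + e) by rewrite -[ltLHS]finvK f_inc// ltrDl.
near=> y.
have /f_le : f (finv x - e) < f (finv y) by rewrite finvK; near: y; exact: lt_nbhsr.
have /f_le : f (finv y) < f (finv x + e) by rewrite finvK; near: y; exact: lt_nbhsl.
by rewrite ltr_distl => ? ?; apply/andP; split; lra.
Unshelve. all: by end_near.
Qed.

End Inverse.

Section Translations.
Variables (R : realType) (f finv : R -> R).
Hypotheses (f_inc : {homo f : x y / x < y}).
Hypotheses (fK : cancel f finv) (finvK : cancel finv f).
Hypotheses (df : forall x, derivable f x 1) (cf' : continuous (derive1 f)).
Local Notation u := (fun p : R * R => finv p.2).
Local Notation chi := (fun p : R * R => f (p.1 + p.2)).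

Lemma translation_continuous (y : R) : continuous (fun t : R => t + y).
Proof. by move=> t; apply: cvgD; [exact: cvg_id|exact: cvg_cst]. Qed.

Lemma translation_characteristic (y : R) :
  characteristic f u setT (fun t => chi (t, y)).
Proof.
split.
- split; first by move=> ? ? _ _ ? _.
  by exists 0, 1; split => //; exact: ltr01.
- move=> t _ /=; rewrite fK; apply: cvg_within_filter.
  apply: (@difference_quotient _ (fun t => f (t + y))).
  rewrite -[X in is_derive _ _ _ X]mulr1.
  apply: (@is_derive1_comp _ f (fun t => t + y)).
    by rewrite derive1E; exact: derivableP.
  by apply: is_derive_eq; rewrite addr0.
- apply: continuous_subspaceT => /=.
  rewrite (_ : (fun _ => _) = derive1 f \o (fun t => t + y)); last first.
    by apply/funext => t /=; rewrite fK.
  by move=> t; apply: continuous_comp; [exact: translation_continuous|exact: cf'].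
Qed.

Lemma translation_parameterization : lagrangian_parameterization f u chi.
Proof.
split.
- move=> p; apply: (@continuous_comp _ _ _ (fun p : R * R => p.1 + p.2) f).
    by apply: cvgD; [exact: cvg_fst|exact: cvg_snd].
  exact/differentiable_continuous/derivable1_diffP.
- exact: translation_characteristic.
- move=> t y1 y2 /=; rewrite -(lerD2l t).
  by rewrite le_eqVlt => /predU1P[->//|/f_inc/ltW].
- move=> [t x] _; exists (t, finv x - t) => //=.
  by rewrite addrC subrK finvK.
Qed.

Lemma translation_path (y : R) : (fun t => u (t, chi (t, y))) = (fun t => t + y).
Proof. by apply/funext => t /=; rewrite fK. Qed.

Lemma translation_source : lagrangian_source u chi (fun=> 1).
Proof.
split.
  split; first exact: measurable_cst.
  by exists 1 => p; rewrite normr1.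
move=> y; rewrite translation_path.
apply: (@distributional_derivative_piecewise _ 1 y 1 y 0 1) => //.
- exact: translation_continuous.
- by move=> t; rewrite normr1.
- by move=> t _; rewrite mul1r.
- by move=> t _; rewrite mul1r.
Qed.

Lemma translation_solution : continuous finv -> lagrangian_solution f u.
Proof.
move=> cfinv; split.
  by move=> p; apply: continuous_comp; [exact: cvg_snd|exact: cfinv].
exists chi; first exact: translation_parameterization.
exists 1 => // y; rewrite translation_path.
by move=> [s t] _ /=; rewrite mul1r opprD addrACA subrr addr0.
Qed.

End Translations.

Section SourceRestriction.
Variables (R : realType) (f finv : R -> R).
Local Notation mu := (@lebesgue_measure R).
Local Notation RR := (measurableTypeR R * measurableTypeR R)%type.
Local Notation u := (fun p : R * R => finv p.2).
Hypotheses (fK : cancel f finv).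

Lemma source_path_measurable (g : R * R -> R) (gamma : R -> R) :
  measurable_fun [set: RR] g -> continuous gamma ->
  measurable_fun [set: R] (fun t => g (t, gamma t)).
Proof.
move=> mg cg; apply: (measurableT_comp mg).
by apply: measurable_fun_pair; [exact: measurable_id|exact: continuous_measurable_fun].
Qed.

(** Along the vertical [u] is constant, so 0 is also a distributional derivative there, and
    uniqueness applies. *)
Lemma vertical_source_eq0 (chi' g : R * R -> R) (x : R) :
  lagrangian_source u chi' g -> includes chi' (fun=> x) ->
  {ae mu, forall t, g (t, x) = 0}.
Proof.
move=> [[mg [M gM]] dg] [y yE].
have chiE t : chi' (t, y) = x by rewrite -[RHS]/((fun=> x) t) -yE.
apply: (@distributional_derivative_unique _ (cst (finv x)) _ (cst 0) M 0).
- by apply: source_path_measurable => // t; exact: cst_continuous.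
- by [].
- exact: measurable_cst.
- by move=> t; rewrite normr0.
- have := dg y; congr distributional_derivative; apply/funext => t /=; by rewrite chiE.
- apply: (@distributional_derivative_piecewise _ 0 (finv x) 0 (finv x) 0 0) => //.
  + by move=> t; exact: cst_continuous.
  + by move=> t; rewrite normr0.
  + by move=> t _; rewrite mul0r add0r.
  + by move=> t _; rewrite mul0r add0r.
Qed.

(** Uniqueness along each path gives the identity for almost every [t] at every fixed [tau]. The
    exceptional set is Borel with null sections, hence null in the plane. *)
Lemma translation_source_eq1 (g : R * R -> R) : continuous f ->
  lagrangian_source u (fun p => f (p.1 + p.2)) g ->
  {ae @lebesgue_measure2 R, forall p, g (p.1, f (p.1 + p.2)) = 1}.
Proof.
move=> cf [[mg [M gM]] dg].
have msum : measurable_fun [set: RR] (fun p : RR => (p.1 + p.2 : R)).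
  by apply: measurable_funD; [exact: measurable_fst|exact: measurable_snd].
have mG : measurable_fun [set: RR] (fun p : RR => g (p.1, f (p.1 + p.2))).
  apply: (measurableT_comp mg); apply: measurable_fun_pair; first exact: measurable_fst.
  by apply: measurableT_comp => //; exact: continuous_measurable_fun.
pose N : set RR := (fun p : RR => g (p.1, f (p.1 + p.2))) @^-1` (~` [set 1]).
have mN : measurable N.
  rewrite -[N]setTI; apply: mG => //.
  by apply: measurableC; exact: measurable_set1.
exists N; split => //.
apply: product_null_ysection => // y; apply: measure_negligible.
  exact: measurable_ysection.
have : {ae mu, forall t, g (t, f (t + y)) = 1}.
  apply: (@distributional_derivative_unique _ (fun t => t + y) _ (cst 1) M 1).
  - apply: (@source_path_measurable g (fun t => f (t + y))) => // t.
    by apply: (@continuous_comp _ _ _ (fun t => t + y) f);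
      [exact: translation_continuous|exact: cf].
  - by [].
  - exact: measurable_cst.
  - by move=> t; rewrite normr1.
  - have := dg y; congr distributional_derivative; apply/funext => t /=; by rewrite fK.
  - apply: (@distributional_derivative_piecewise _ 1 y 1 y 0 1) => //.
    + exact: translation_continuous.
    + by move=> t; rewrite normr1.
    + by move=> t _; rewrite mul1r.
    + by move=> t _; rewrite mul1r.
by apply: negligibleS => t; rewrite /ysection /= inE.
Qed.

End SourceRestriction.
Theorem mainTheorem4 (R : realType) (f finv : R -> R)
    (f_increasing : {homo f : x y / x < y})
    (fK : cancel f finv) (finvK : cancel finv f)
    (f_C2 : C2 f) :
  let S := [set z | f^`() z = 0] in
  forall (S01 : S `<=` `[0, 1])
    (S_pos : (0 < @lebesgue_measure R S)%E)
    (S_nointerval : forall J, nondegenerate_interval J -> ~ (J `<=` S)),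
  let u := fun p : R * R => finv p.2 in
  let chi := fun p : R * R => f (p.1 + p.2) in
  continuous u /\
  (* (1) *)
  distributional_balance_law f u (fun=> 1) /\
  (* (2) *)
  (~ broad_solution f u /\
   exists I gamma, [/\ characteristic f u I gamma,
     ~ absolutely_continuous_on I (fun t => u (t, gamma t)) &
     ~ exists G : R, G.-lipschitz_I (fun t => u (t, gamma t))]) /\
  (* (3) *)
  [/\ lagrangian_solution f u,
      lagrangian_parameterization f u chi,
      forall t tau : R, is_derive t 1 (fun s => u (s, chi (s, tau))) 1 &
      lagrangian_source u chi (fun=> 1)] /\
  (* (4) *)
  (exists chi',
    [/\ lagrangian_parameterization f u chi',
        forall x, (f @` S) x -> includes chi' (fun=> x),
        exists g, lagrangian_source u chi' g &
        ~ exists g, lagrangian_source u chi g /\ lagrangian_source u chi' g]) /\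
  ~ exists g, [/\ bounded_borel g,
      {ae @lebesgue_measure2 R, forall p, g (p.1, chi p) = 1} &
      forall x, (f @` S) x ->
        {ae @lebesgue_measure R, forall t, g (t, x) = 0}].
Proof.
move=> S S01 S_pos S_nointerval u chi.
have [df [ddf _]] := f_C2.
have cf : continuous f by move=> x; apply/differentiable_continuous/derivable1_diffP.
have cf' : continuous (derive1 f).
  by move=> x; apply/differentiable_continuous/derivable1_diffP.
have cfinv := increasing_inverse_continuous f_increasing finvK.
have cu : continuous u.
  by move=> p; apply: continuous_comp; [exact: cvg_snd|exact: cfinv].
have SE x : S x -> derive1 f x = 0 by [].
have Sclosed : closed S.
  by apply: (@closed_comp _ _ (derive1 f) [set 0]) => [? _|]; [exact: cf'|exact: closed_eq].
have S_neq0 : S !=set0.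
  apply/set0P/eqP => S0; move: S_pos; rewrite S0 measure0.
  by rewrite ltxx.
pose Z := decompressed Sclosed S01.
have ZE : (fun t => u (t, (f \o Z) t)) = Z by apply/funext => t; rewrite /u /= fK.
have charZ : characteristic f u setT (f \o Z).
  exact: (characteristic_decompressed df cf' SE Sclosed S01 S_nointerval (fun _ x => fK x)).
(* These are the times at which the jumping path is in [[-1, 1]], an interval that contains [S]. *)
have nAC : ~ absolutely_continuous_itv
    (compressed S (-1)) (compressed S 1) (fun t => u (t, (f \o Z) t)).
  rewrite ZE; exact: (@decompressed_not_AC R S Sclosed S01 S_nointerval S_pos).
have nLip : ~ exists G : R, G.-lipschitz_setT (fun t => u (t, (f \o Z) t)).
  by move=> [G hG]; apply: nAC; apply: lipschitz_AC hG.
split; first exact: cu.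
split; first exact: (balance_law_inverse finvK cfinv).
split.
  split.
    by move=> [_ [G G0 hG]]; apply: nLip; exists G; exact: hG charZ.
  exists setT, (f \o Z); split; [exact: charZ| |exact: nLip].
  move=> h; apply: nAC; apply: h; last by [].
  by rewrite (@compressed_le R S Sclosed S01 S_nointerval) ge0_cp ?ler01.
have no_common (g : R * R -> R) :
    [/\ bounded_borel g, {ae @lebesgue_measure2 R, forall p, g (p.1, chi p) = 1} &
      forall x, (f @` S) x -> {ae @lebesgue_measure R, forall t, g (t, x) = 0}] -> False.
  move=> [[mg _] g1 g0]; apply: (no_common_source cf (closed_measurable Sclosed) S_pos mg g1).
  by move=> s Ss; apply: g0; exists s.
split.
  split.
  - exact: (translation_solution f_increasing fK finvK df cf' cfinv).
  - exact: (translation_parameterization f_increasing fK finvK df cf').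
  - move=> t tau; rewrite (translation_path fK).
    by apply: is_derive_eq; rewrite addr0.
  - exact: (translation_source fK).
split; last by move=> [g /no_common].
exists (fun p => f (stopped Sclosed p.2 p.1)); split.
- exact: (stopped_parameterization df cf' f_increasing fK finvK SE Sclosed S_neq0).
- by move=> x Sx; exact: (stopped_includes Sclosed Sx).
- exists (moving_source finv S); exact: (stopped_source fK cfinv Sclosed S_neq0).
- move=> [g [g1 g0]]; apply: (no_common g); split.
  + by case: g1.
  + exact: (translation_source_eq1 fK cf g1).
  + move=> x Sx; exact: (vertical_source_eq0 g0 (stopped_includes Sclosed Sx)).
Qed.
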